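(* For $N_1,N_2\ge1$ consider $W(\mathsf D_{N_1+N_2+1})$ with indices $\{1,\dots,N_1+N_2+1\}$, and put $\ast=N_1+N_2+1$. Realize a group $G$ on the indices $\{1,\dots,N_1\}\cup\{\ast\}$ and a group $G'$ on the indices $\{N_1+1,\dots,N_1+N_2\}\cup\{\ast\}$ (shifting the indices $1,\dots,N_2$ of $G'$ by $N_1$), where each of $G,G'$ is one of the following (with its length-one orbit identified with $\ast$): (a) $\mathfrak D_{2m+1}$, $N=2m+1$: generated by $g_1=c_1c_2\cdots c_{2m+1}c_\ast(2,3)(4,5)\cdots(2m,2m+1)$ and the $(2m+1)$-cycle $g_2=(1,2,4,6,\dots,2m,2m+1,2m-1,\dots,5,3)$; (b) $\mathfrak F_{q}$, $q=p^r$ with $p$ an odd prime, $N=q$: generated by $g_1=c_1\cdots c_{q}c_\ast\,\mu_\Gamma$ and $g_2=\nu$, where, identifying $\{1,\dots,q\}$ with $\mathbb F_q$ via the labelling $\mathrm{lab}$ below, $\mu_\Gamma(\mathrm{lab}(a))=\mathrm{lab}(\Gamma a)$ for a fixed generator $\Gamma$ of $\mathbb F_q^*$ and $\nu(\mathrm{lab}(a))=\mathrm{lab}(a+1)$. Then the subgroups $\mathfrak D_{2n_1+1}\times\mathfrak D_{2n_2+1}$ (both factors of type (a)) and $\mathfrak D_{2n+1}\times\mathfrak F_{p^r}$ (first factor of type (a), second of type (b)) of $W(\mathsf D_{N_1+N_2+1})$ generated by the four generators satisfy the (H1) condition and the relative minimality condition.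
   Context: $W(\mathsf B_m)$ is the group of signed permutations of the symbols $j^\pm$ ($1\le j\le m$), generated by permutations of indices and involutions $c_j$ exchanging $j^+,j^-$; elements are $c_{j_1}\cdots c_{j_t}\tau$; $\sigma(\cdot)=(-1)^t$; $W(\mathsf D_m)=\ker\sigma$. $W(\mathsf D_m)$ acts on $\bigoplus_{i=-1}^m\mathbb Zl_i$ (the geometric Picard lattice of a standard conic bundle with $m$ degenerate fibers) via $\Phi$: for $g=c_{j_1}\cdots c_{j_t}\tau$ with $s(i)=-1$ iff $i\in\{j_1,\dots,j_t\}$, $\Phi(g)l_0=l_0$, $\Phi(g)l_{-1}=l_{-1}+\frac t2l_0-\sum_{s(i)=-1}l_i$, $\Phi(g)l_v=l_u$ or $l_0-l_u$ ($u=\tau^{-1}(v)$) according as $s(u)=1$ or $-1$. A subgroup $H$ satisfies (H1) if $\mathrm H^1(H',\mathbb Z^{m+2})=0$ for all subgroups $H'\subseteq H$, and relative minimality if its invariant sublattice is $\mathbb Zl_0\oplus\mathbb ZK$, $K=-2(l_{-1}+l_0)+\sum_{i=1}^ml_i$. Labelling: $\mathbb F_{p^r}=(\mathbb Z/p)[x]/(h(x))$ with $h$ monic irreducible of degree $r$; for $a=a_0+a_1x+\dots+a_{r-1}x^{r-1}$ ($a_i\in\{0,\dots,p-1\}$), $\mathrm{lab}(a)=a_0+a_1p+\dots+a_{r-1}p^{r-1}$ if $a\ne0$ and $\mathrm{lab}(0)=p^r$. Permutations written in cycle notation $(a_1,\dots,a_w)$ send $a_i\mapsto a_{i+1}$.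 *)

(* Defs.v *)
From HB Require Import structures.
From mathcomp Require Import all_boot all_order all_algebra all_fingroup.
Set Implicit Arguments. Unset Strict Implicit. Unset Printing Implicit Defensive.
Import GRing.Theory.
Local Open Scope ring_scope.

(* Signed permutations.  The symbols j^+ / j^- (1 <= j <= M'.+1) are   *)
(* encoded as (i, true) / (i, false) with i : 'I_M'.+1, i = j - 1.      *)
(* Products follow MathComp's convention (g * h) x = h (g x), i.e.     *)
(* left-to-right composition, as in the cycle/word conventions of the  *)
(* paper (g = c_{j1}..c_{jt} tau : first the sign changes, then tau).   *)

Definition sflip (M : nat) (x : 'I_M * bool) : 'I_M * bool := (x.1, ~~ x.2).

Definition WB (M : nat) : {set {perm 'I_M * bool}} :=
  [set g : {perm 'I_M * bool} | [forall x, g (sflip x) == sflip (g x)]].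

Definition sneg (M : nat) (g : {perm 'I_M * bool}) (i : 'I_M) : bool :=
  ~~ (g (i, true)).2.
Definition stau (M : nat) (g : {perm 'I_M * bool}) (i : 'I_M) : 'I_M :=
  (g (i, true)).1.
Definition snum (M : nat) (g : {perm 'I_M * bool}) : nat :=
  #|[set i | sneg g i]|.

Definition WD (M : nat) : {set {perm 'I_M * bool}} :=
  [set g in WB M | ~~ odd (snum g)].

(* The lattice  Z l_{-1} + Z l_0 + Z l_1 + ... + Z l_M  = 'cV[int]_(2+M)*)
(* index lshift M 0 <-> l_{-1}, lshift M 1 <-> l_0,                     *)
(* rshift 2 i <-> l_{i+1}  (i : 'I_M).                                  *)
(* Phi g is the matrix of Phi(g) (column b = image of basis vector b).  *)

Definition Phi_entry (M : nat) (g : {perm 'I_M * bool}) (a b : 'I_(2 + M)) : int :=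
  match split a, split b with
  | inl a', inl b' =>
      if (b' : nat) == 0%N then
        (if (a' : nat) == 0%N then 1 else ((snum g)./2)%:Z)
      else ((a' : nat) == 1%N)%:Z
  | inr u, inl b' =>
      if (b' : nat) == 0%N then - ((sneg g u)%:Z) else 0
  | inl a', inr v =>
      if (a' : nat) == 0%N then 0
      else (#|[set u | (stau g u == v) && sneg g u]|)%:Z
  | inr u, inr v =>
      if stau g u == v then (if sneg g u then -1 else 1) else 0
  end.

Definition Phi (M : nat) (g : {perm 'I_M * bool}) : 'M[int]_(2 + M) :=
  \matrix_(a, b) Phi_entry g a b.

Definition H1_zero (M : nat) (H' : {set {perm 'I_M * bool}}) : Prop :=
  forall f : {perm 'I_M * bool} -> 'cV[int]_(2 + M),
    (forall g h, g \in H' -> h \in H' -> f (g * h)%g = f g + Phi g *m f h) ->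
    exists v : 'cV[int]_(2 + M), forall g, g \in H' -> f g = Phi g *m v - v.

Definition condH1 (M : nat) (H : {set {perm 'I_M * bool}}) : Prop :=
  forall H' : {group {perm 'I_M * bool}}, H' \subset H -> H1_zero H'.

Definition vl0 (M : nat) : 'cV[int]_(2 + M) :=
  \col_a (match split a with inl a' => ((a' : nat) == 1%N)%:Z | inr _ => 0 end).

Definition vK (M : nat) : 'cV[int]_(2 + M) :=
  \col_a (match split a with inl _ => -2 | inr _ => 1 end).

Definition rel_minimal (M : nat) (H : {set {perm 'I_M * bool}}) : Prop :=
  forall x : 'cV[int]_(2 + M),
    (forall g, g \in H -> Phi g *m x = x) <->
    exists a b : int, x = a *: vl0 M + b *: vK M.

(* the permutation with graph f (f is injective in all uses below) *)
Definition mkperm (T : finType) (f : T -> T) : {perm T} :=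
  match injectiveP f with
  | ReflectT inj => perm inj
  | ReflectF _ => 1%g
  end.

(* Local description of a generator on labels {1..N} u {*}: an index map
   tau on {1..N} (fixing * ) and a flag saying whether the generator is
   c_1 ... c_N c_* tau (flag = true) or just tau (flag = false).
   [embed off N tau fl star] transports it to the global labels, shifting
   1..N to off+1..off+N and identifying * with the global label [star].
   The result gives, for a global label u, the label of the image of u^+
   together with "the sign is changed". *)
Definition embed (off N : nat) (tau : nat -> nat) (fl : bool) (star : nat)
  (u : nat) : nat * bool :=
  if (off < u <= off + N)%N then (off + tau (u - off), fl)%N
  else (u, fl && (u == star)).

Definition sperm (M' : nat) (f : nat -> nat * bool) : {perm 'I_M'.+1 * bool} :=
  mkperm (fun x : 'I_M'.+1 * bool =>
            (inord (f x.1.+1).1.-1, x.2 (+) (f x.1.+1).2)).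

Definition gens (N1 N2 : nat) (t1 t2 t1' t2' : nat -> nat)
  : {set {perm 'I_(N1 + N2).+1 * bool}} :=
  let star := (N1 + N2).+1 in
  [set @sperm (N1 + N2) (embed 0 N1 t1 true star);
       @sperm (N1 + N2) (embed 0 N1 t2 false star);
       @sperm (N1 + N2) (embed N1 N2 t1' true star);
       @sperm (N1 + N2) (embed N1 N2 t2' false star)].

Definition tauD1 (n : nat) (k : nat) : nat :=
  if (2 <= k <= 2 * n + 1)%N then (if odd k then k.-1 else k.+1) else k.
Definition cycD (n : nat) : seq nat :=
  (1 :: [seq 2 * i | i <- iota 1 n] ++ [seq 2 * n + 1 - 2 * i | i <- iota 0 n])%N.
Definition tauD2 (n : nat) (k : nat) : nat := next (cycD n) k.

(* ---- type (b): F_q, q = p^r, F_q = F_p[x]/(h) ---- *)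
Definition unlab (p r k : nat) : {poly 'F_p} :=
  if k == (p ^ r)%N then 0 else \poly_(i < r) (((k %/ p ^ i) %% p)%N%:R).
Definition lab (p r : nat) (a : {poly 'F_p}) : nat :=
  if a == 0 then (p ^ r)%N else (\sum_(i < r) nat_of_ord (a`_i)%R * p ^ i)%N.
Arguments unlab p r k : clear implicits.
Arguments lab p r a : clear implicits.
Definition tauMu (p r : nat) (h Gam : {poly 'F_p}) (k : nat) : nat :=
  lab p r ((Gam * unlab p r k) %% h).
Definition tauNu (p r : nat) (k : nat) : nat :=
  lab p r (unlab p r k + 1).

Arguments tauMu p r h Gam k : clear implicits.
(* Gam (a reduced polynomial, i.e. an element of F_p[x]/(h)) generates F_q^* *)
Definition generates_units (p r : nat) (h Gam : {poly 'F_p}) : Prop :=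
  (size Gam <= r)%N /\
  forall a : {poly 'F_p}, (size a <= r)%N -> a != 0 ->
    exists k : nat, a = Gam ^+ k %% h.

Arguments generates_units p r h Gam : clear implicits.
Arguments sperm M' f : clear implicits.
Definition H1_and_minimal (M' : nat) (H : {set {perm 'I_M'.+1 * bool}}) : Prop :=
  H \subset WD M'.+1 /\ condH1 H /\ rel_minimal H.

(* Main.v *)
(* A conic bundle with degenerate fibres has trivial first cohomology as soon
   as no proper nonempty subset of the non-split orbits of fibres has trivial
   product of sign characters.  Here the fibres fall into three blocks (the
   indices of each factor and the common index), on each of which an element
   changes all signs or none, with characters E1, E2 and E3 = E1 E2.  A
   sign-changing element is an affine map x -> u x + b with 1 - u invertible, so
   it fixes at most one index of its block; by counting, each block then contains
   at most one non-split orbit.  Hence a cocycle becomes a coboundary on block i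
   after adding a multiple a_i of E_i, with a_i in Z/2, and the evenness imposed
   by the coefficient of l_0 reads a_1 E1 + a_2 E2 + a_3 E3 = 0, which makes the
   a_i of the nontrivial E_i coincide; the common value is absorbed by l_{-1}.
   Relative minimality follows from transitivity on the first two blocks,
   because every index is fixed by some element changing its sign. *)
Require Import Defs.
From HB Require Import structures.
From mathcomp Require Import all_boot all_order all_algebra all_fingroup.
From mathcomp Require Import zify ring.

Set Implicit Arguments. Unset Strict Implicit. Unset Printing Implicit Defensive.
Import GRing.Theory Num.Theory.
Local Open Scope group_scope.
Local Open Scope ring_scope.

(** * Cocycles of permutation modules *)

(** Values lie in the permutation module of integer functions on [T], where [g] acts by
    [b |-> b \o g]; products compose from left to right. *)
Definition perm_cocycle (T : finType) (G : {set {perm T}})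
    (c : {perm T} -> T -> int) : Prop :=
  forall g h x, g \in G -> h \in G -> c (g * h)%g x = c g x + c h (g x).

(** The choice depends only on the orbit as a set, so it is constant along the orbit. *)
Definition orbit_rep (T : finType) (G : {group {perm T}}) (x : T) : T :=
  odflt x [pick y in orbit 'P G x].

Lemma mem_orbit_perm (T : finType) (G : {group {perm T}}) (g : {perm T}) x :
  g \in G -> g x \in orbit 'P G x.
Proof. by move=> gG; rewrite -[g x]/('P%act x g) mem_orbit. Qed.

Lemma orbit_rep_in (T : finType) (G : {group {perm T}}) (x : T) :
  orbit_rep G x \in orbit 'P G x.
Proof. by rewrite /orbit_rep; case: pickP => // /(_ x); rewrite orbit_refl. Qed.

Lemma orbit_rep_act (T : finType) (G : {group {perm T}}) (g : {perm T}) x :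
  g \in G -> orbit_rep G (g x) = orbit_rep G x.
Proof.
move=> gG; have /orbit_eqP eqo := mem_orbit_perm x gG.
rewrite /orbit_rep eqo; case: pickP => // /(_ x).
by rewrite orbit_refl.
Qed.

(** Elements of a finite group have finite order, and the integers are torsion-free. *)
Lemma group_hom_int0 (gT : finGroupType) (G : {group gT}) (f : gT -> int) :
  {in G &, forall g h, f (g * h)%g = f g + f h} -> {in G, forall g, f g = 0}.
Proof.
move=> fM g gG; have f1 : f 1%g = 0.
  have := fM _ _ (group1 G) (group1 G).
  by rewrite mulg1 -[LHS]addr0 => /addrI.
have fX n : f (g ^+ n)%g = f g *+ n.
  elim: n => [|n IHn]; first by rewrite expg0 mulr0n f1.
  by rewrite expgS fM ?groupX // IHn mulrS.
have := fX #[g]%g; rewrite expg_order f1 => /esym/eqP.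
by rewrite mulrn_eq0 -leqn0 leqNgt order_gt0 /= => /eqP.
Qed.

(** On the stabiliser of [x], evaluation at [x] turns the cocycle into a homomorphism to the
    integers. *)
Lemma cocycle_fix (T : finType) (G : {group {perm T}}) c (g : {perm T}) x :
  perm_cocycle G c -> g \in G -> g x = x -> c g x = 0.
Proof.
move=> cM gG gx; have stab h : (h \in 'C_G[x | 'P]) = (h \in G) && (h x == x).
  by rewrite inE; congr andb; apply/astab1P/eqP.
apply: (@group_hom_int0 _ [group of 'C_G[x | 'P]] (c^~ x)).
  by move=> h k; rewrite !stab => /andP[hG /eqP hx] /andP[kG _]; rewrite cM // hx.
by rewrite stab gG gx eqxx.
Qed.

Lemma cocycle_eq (T : finType) (G : {group {perm T}}) c (g h : {perm T}) x :
  perm_cocycle G c -> g \in G -> h \in G -> g x = h x -> c g x = c h x.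
Proof.
move=> cM gG hG eqx; have ghG : (g * h^-1)%g \in G by rewrite groupM ?groupV.
have fx : (g * h^-1)%g x = x by rewrite permM eqx permK.
by rewrite -{1}[g](mulgKV h) cM // fx (cocycle_fix cM ghG fx) add0r.
Qed.

(** The first cohomology of a permutation module vanishes: for given [x], [c g x] depends only on
    [g x], so transport of each point to its orbit representative yields a potential [b]. *)
Lemma cocycle_cobound (T : finType) (G : {group {perm T}}) c :
  perm_cocycle G c ->
  exists b : T -> int, forall g x, g \in G -> c g x = b (g x) - b x.
Proof.
move=> cM.
pose k x := odflt 1%g [pick g in G | g x == orbit_rep G x].
have kP x : k x \in G /\ k x x = orbit_rep G x.
  rewrite /k; case: pickP => [g /andP[gG /eqP gx]|no] //=.
  have /orbitP[g gG gx] := orbit_rep_in G x.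
  by have := no g; rewrite gG /= -gx eqxx.
exists (fun x => - c (k x) x) => g x gG.
have [kxG kx] := kP x; have [kgG kg] := kP (g x).
have eqx : (g * k (g x))%g x = k x x by rewrite permM kg kx orbit_rep_act.
have := cocycle_eq cM (groupM gG kgG) kxG eqx.
by rewrite cM // opprK => <-; rewrite addrCA addNr addr0.
Qed.

Lemma flip_cobound_even (T : finType) (G : {group {perm T}}) c
    (s : T -> T) (b : T -> int) (g : {perm T}) x :
  (forall g x, g \in G -> c g x = b (g x) - b x) -> g \in G -> g x = s x ->
  b x + b (s x) = b x *+ 2 + c g x.
Proof. by move=> cE gG gx; rewrite cE // gx mulr2n addrACA subrr addr0. Qed.

(* The trivialisation [b] of [c] can be corrected, orbit by orbit, by a
   constant: the defect [e x = b x + b (s x)] is invariant under [G] and [s];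
   it is split evenly on an orbit stable under [s], and otherwise absorbed
   entirely by one of the two orbits exchanged by [s]. *)
Lemma odd_cobound (T : finType) (G : {group {perm T}}) c (s : T -> T)
    (A : {pred T}) :
  perm_cocycle G c -> involutive s ->
  (forall g x, g \in G -> g (s x) = s (g x)) ->
  (forall g x, g \in G -> c g (s x) = - c g x) ->
  (forall g x, g \in G -> x \in A -> g x = s x -> (2 %| c g x)%Z) ->
  exists b : T -> int,
    (forall x, x \in A -> b (s x) = - b x) /\
    (forall g x, g \in G -> c g x = b (g x) - b x).
Proof.
move=> cM sK sG cs even_c; have [b bE] := cocycle_cobound cM.
pose e x := b x + b (s x).
have eG g x : g \in G -> e (g x) = e x.
  move=> gG; apply/eqP; rewrite -subr_eq0 /e -sG // opprD addrACA.
  by rewrite -!bE // cs // subrr.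
have es x : e (s x) = e x by rewrite /e sK addrC.
have osym x : (s (s x) \in orbit 'P G (s x)) = (s x \in orbit 'P G x).
  by rewrite sK orbit_sym.
pose r := orbit_rep G.
(* The ranks of the representatives single out one of the two orbits exchanged by [s]. *)
pose q x := (enum_rank (r x) < enum_rank (r (s x)))%N.
pose d x := if s x \in orbit 'P G x then - (e x %/ 2)%Z
            else if q x then - e x else 0.
have dG g x : g \in G -> d (g x) = d x.
  move=> gG; rewrite /d /q /r -sG // !orbit_rep_act // eG //.
  have /orbit_eqP-> := mem_orbit_perm x gG.
  suff -> : (g (s x) \in orbit 'P G x) = (s x \in orbit 'P G x) by [].
  by rewrite [LHS]orbit_sym [RHS]orbit_sym; have /orbit_eqP-> := mem_orbit_perm (s x) gG.
exists (fun x => b x + d x); split=> [x xA | g x gG]; last first.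
  by rewrite dG // bE // opprD addrACA subrr addr0.
apply/eqP; rewrite -subr_eq0 opprK addrACA addrC [b (s x) + _]addrC -/(e x).
suff -> : d (s x) + d x = - e x by rewrite addNr.
rewrite /d osym es; case: ifPn => [/orbitP[g gG gx] | nox].
  (* An element with [g x = s x] gives [e x = 2 b x + c g x], which is even, so the halving in [d]
     is exact. *)
  have e2 : (2 %| e x)%Z.
    have /dvdzP[z cz] := even_c g x gG xA gx.
    apply/dvdzP; exists (b x + z).
    rewrite /e (flip_cobound_even bE gG gx) cz; lia.
  by have /divzK := e2; lia.
have rN : r x != r (s x).
  apply: contra nox => /eqP rE; have := orbit_rep_in G (s x).
  by rewrite orbit_sym -/r -rE => /orbit_trans; apply; apply: orbit_rep_in.
rewrite /q sK; case: ltngtP => [lt|lt|/val_inj/enum_rank_inj/esym/eqP].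
- by rewrite addr0.
- by rewrite add0r.
by rewrite (negPf rN).
Qed.

(** If [h] sends [y] to [x] and [k] sends [x] to [z], these elements are exactly the products
    [h a k] with [a] in the stabiliser of [x]. *)
Lemma card_mapsto (T : finType) (G : {group {perm T}}) (x y z : T) :
  y \in orbit 'P G x -> z \in orbit 'P G x ->
  #|[set h in G | h y == z]| = #|'C_G[x | 'P]|.
Proof.
move=> yX /orbitP[k kG <-]; have /orbitP[h hG hy] : x \in orbit 'P G y by rewrite orbit_sym.
suff -> : [set h in G | h y == 'P%act x k] = [set (h * a * k)%g | a in 'C_G[x | 'P]].
  by rewrite card_imset // => a b /mulIg/mulgI.
apply/setP=> a; rewrite inE; apply/andP/imsetP => [[aG /eqP ay] | [b]].
  exists (h^-1 * a * k^-1)%g; last by rewrite !mulgA mulgV mul1g mulgKV.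
  apply/setIP; split; first by rewrite !groupM ?groupV.
  apply/astab1P; rewrite /= /aperm.
  by rewrite !permM -{1}hy /= /aperm permK ay /= /aperm permK.
case/setIP=> bG /astab1P bx ->; split; first by rewrite !groupM.
by rewrite !permM (hy : h y = x) (bx : b x = x).
Qed.

Lemma card_odd_elements (T : finType) (G : {group {perm T}})
    (E : {perm T} -> bool) g :
  {in G &, forall g h, E (g * h)%g = E g (+) E h} -> g \in G -> E g ->
  (2 * \sum_(h in G) E h = #|G|)%N.
Proof.
move=> EM gG Eg; rewrite mul2n -addnn.
(* Left translation by the odd element [g] exchanges odd and even elements, so each [h] contributes
   [E (g h) + E h = 1]. *)
rewrite [X in (X + _)%N](reindex_inj (mulgI g)) /=.
under eq_bigl => h do rewrite groupMl //.
rewrite -big_split /= -sum1_card; apply: eq_bigr => h hG.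
by rewrite EM // Eg; case: (E h).
Qed.

(* Inside [A], any two points flipped by elements of [G] are in one orbit:
   with [X] the orbit of a flipped point, counting the pairs [(h, y)] with
   [y \in X] and [h y = s y] by [y] gives [#|G|], whereas each of the
   [#|G| / 2] odd elements contributes at most two pairs. *)
Lemma flipped_one_orbit (T : finType) (G : {group {perm T}})
    (E : {perm T} -> bool) (s : T -> T) (A : {set T}) :
  {in G &, forall g h, E (g * h)%g = E g (+) E h} ->
  involutive s ->
  (forall g x, g \in G -> g (s x) = s (g x)) ->
  (forall g x, g \in G -> x \in A -> g x \in A) ->
  (forall g x, g \in G -> x \in A -> g x = s x -> E g) ->
  (forall g x y, g \in G -> x \in A -> y \in A -> g x = s x -> g y = s y ->
     y = x \/ y = s x) ->
  forall g g' x y, g \in G -> g' \in G -> x \in A -> y \in A ->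
    g x = s x -> g' y = s y -> y \in orbit 'P G x.
Proof.
move=> EM sK sG AG AE Auniq g g' x y gG g'G xA yA gx g'y.
apply/negPn/negP => nyX; set X := orbit 'P G x in nyX.
have XA z : z \in X -> z \in A by case/orbitP=> h hG <-; apply: AG.
have sX z : z \in X -> s z \in X.
  case/orbitP=> h hG <-; rewrite /= /aperm -sG // -gx -permM.
  by rewrite mem_orbit_perm // groupM.
pose F (h : {perm T}) := #|[set z in X | h z == s z]|.
have sumF : (\sum_(h in G) F h = #|G|)%N.
  under eq_bigr => h _ do rewrite /F -sum1dep_card.
  rewrite (exchange_big_dep (mem X)) /=; last by move=> h z _ /andP[].
  rewrite -(card_orbit_stab 'P G x) -/X -sum_nat_const.
  apply: eq_bigr => z zX; rewrite -(card_mapsto zX (sX z zX)) -sum1dep_card.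
  by apply: eq_bigl => h; rewrite zX.
have Fle h : h \in G -> (F h <= 2 * E h)%N.
  move=> hG; rewrite /F; case: (set_0Vmem [set z in X | h z == s z]) => [->|[z]].
    by rewrite cards0.
  rewrite inE => /andP[zX /eqP hz]; rewrite (AE h z) ?XA //.
  apply: (@leq_trans #|[set z; s z]|); last by rewrite cards2; case: (_ != _).
  apply/subset_leq_card/subsetP=> t; rewrite !inE => /andP[tX /eqP ht].
  by case: (Auniq h z t hG (XA z zX) (XA t tX) hz ht) => ->; rewrite eqxx ?orbT.
(* The only points of [A] flipped by the odd element [g'] are [y] and [s y], both outside [X]; its
   missing contribution of 2 breaks the equality of the counts. *)
have F0 : F g' = 0%N.
  apply/eqP; rewrite cards_eq0; apply/eqP/setP=> z; rewrite !inE.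
  apply/negP=> /andP[zX /eqP g'z].
  case: (Auniq g' z y g'G (XA z zX) yA g'z g'y) => yE; move: nyX.
    by rewrite yE zX.
  by rewrite yE sX.
have := card_odd_elements EM gG (AE g x gG xA gx).
rewrite -sumF (bigD1 g') //= [X in _ = X](bigD1 g') //= F0 (AE g' y) //=.
rewrite mulnDr add0n => eqF.
have : (\sum_(h in G | h != g') F h <= \sum_(h in G | h != g') 2 * E h)%N.
  by apply: leq_sum => h /andP[hG _]; apply: Fle.
by rewrite -big_distrr /= -eqF; lia.
Qed.

(** * Blocks of indices with constant sign *)

Lemma sflipK (M : nat) : involutive (@sflip M).
Proof. by case=> u s; rewrite /sflip /= negbK. Qed.

Lemma WB_act (M : nat) (g : {perm 'I_M * bool}) u s :
  g \in WB M -> g (u, s) = (stau g u, s (+) sneg g u).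
Proof.
rewrite inE => /forallP/(_ (u, true))/eqP; rewrite /stau /sneg /sflip /=.
by case: s; case: (g (u, true)) => v [] /=.
Qed.

Lemma WBP (M : nat) (g : {perm 'I_M * bool}) (t : 'I_M -> 'I_M) (e : 'I_M -> bool) :
  (forall u s, g (u, s) = (t u, s (+) e u)) -> g \in WB M.
Proof.
move=> gE; rewrite inE; apply/forallP=> -[u s]; rewrite /sflip !gE /=.
by rewrite addNb.
Qed.

Lemma stauM (M : nat) (g h : {perm 'I_M * bool}) u :
  g \in WB M -> h \in WB M -> stau (g * h)%g u = stau h (stau g u).
Proof. by move=> gW hW; rewrite {1}/stau permM !WB_act. Qed.

Lemma snegM (M : nat) (g h : {perm 'I_M * bool}) u :
  g \in WB M -> h \in WB M ->
  sneg (g * h)%g u = sneg g u (+) sneg h (stau g u).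
Proof. by move=> gW hW; rewrite {1}/sneg permM !WB_act //=; case: (sneg g u); case: sneg. Qed.

Lemma group_set_WB (M : nat) : group_set (WB M).
Proof.
apply/group_setP; split=> [|g h gW hW].
  by rewrite inE; apply/forallP=> x; rewrite !perm1.
by apply: (WBP (t := stau (g * h)%g) (e := sneg (g * h)%g)) => u s;
  rewrite stauM // snegM // permM !WB_act // addbA.
Qed.
Canonical WB_group M := Group (group_set_WB M).

Lemma stau1 (M : nat) (u : 'I_M) : stau 1%g u = u.
Proof. by rewrite /stau perm1. Qed.

Lemma stau_inj (M : nat) (g : {perm 'I_M * bool}) : g \in WB M -> injective (stau g).
Proof.
move=> gW; apply: (@can_inj _ _ _ (stau g^-1%g)) => u.
by rewrite -stauM ?groupV // mulgV stau1.
Qed.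

(** The last clause makes the non-split orbit in [U] unique; the odd cardinality lets a sum over [U]
    detect the parity of a term repeated on all of [U]. *)
Definition sign_block (M : nat) (H : {set {perm 'I_M * bool}}) (U : {set 'I_M})
    (E : {perm 'I_M * bool} -> bool) : Prop :=
  [/\ odd #|U|,
      forall g u, g \in H -> u \in U -> stau g u \in U,
      forall g u, g \in H -> u \in U -> sneg g u = E g &
      forall g u v, g \in H -> E g -> u \in U -> v \in U ->
        stau g u = u -> stau g v = v -> u = v].

Lemma sign_blockS (M : nat) (H H' : {set {perm 'I_M * bool}}) U E :
  H' \subset H -> sign_block H U E -> sign_block H' U E.
Proof.
move=> /subsetP sH [oddU stU sgU fxU]; split=> // [g u /sH|g u /sH|g u v /sH].
- exact: stU.
- exact: sgU.
- exact: fxU.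
Qed.

(** * Reduction modulo 2 *)

Definition parity (z : int) : 'F_2 := z%:~R.

Lemma parityD : {morph parity : x y / x + y}. Proof. exact: intrD. Qed.
Lemma parityN x : parity (- x) = parity x.
Proof.
rewrite /parity mulrNz; case: (x%:~R : 'F_2) => [[|[|//]] ?]; exact: val_inj.
Qed.
Lemma parity_even x : (2 %| x)%Z = (parity x == 0).
Proof. by apply: (@dvdz_pcharf 'F_2 2); apply: pchar_Fp. Qed.
Lemma F2_double (x : 'F_2) : x + x = 0.
Proof. by case: x => [[|[|//]] ?]; exact: val_inj. Qed.
Lemma parity_nat n : parity n%:Z = (odd n)%:R.
Proof.
rewrite /parity -[in LHS](odd_double_half n) -pmulrn natrD -addnn natrD.
by rewrite F2_double addr0.
Qed.

Definition vsign (b : bool) : int := if b then 1 else -1.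

(** The odd extension from indices to the symbols [j^+], [j^-]: it places a signed permutation
    module inside an ordinary one, where [cocycle_cobound] applies. *)
Definition signed_ext (M : nat) (c : {perm 'I_M * bool} -> 'I_M -> int) g
  (x : 'I_M * bool) : int := vsign x.2 * c g x.1.

Definition signed_cocycle (M : nat) (G : {set {perm 'I_M * bool}})
    (c : {perm 'I_M * bool} -> 'I_M -> int) : Prop :=
  forall g h u, g \in G -> h \in G ->
    c (g * h)%g u = c g u + vsign (~~ sneg g u) * c h (stau g u).

Lemma signed_cocycle_ext (M : nat) (G : {set {perm 'I_M * bool}}) c :
  G \subset WB M -> signed_cocycle G c -> perm_cocycle G (signed_ext c).
Proof.
move=> /subsetP GW cM g h [u s] gG hG; rewrite /signed_ext /= WB_act ?GW //= cM //.
by rewrite mulrDr mulrA; congr (_ + _ * _); case: s; case: sneg.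
Qed.

(** The obstruction to an odd trivialisation is the parity of the cocycle at a symbol flipped by
    some element. All flipped symbols of the block lie in one orbit, so one bit [a] records this
    parity, and adding [a E] removes it. *)
Lemma block_cobound (M : nat) (G : {group {perm 'I_M * bool}}) U E c :
  G \subset WB M -> sign_block G U E -> signed_cocycle G c ->
  exists (a : bool) (b : 'I_M -> int), forall g u, g \in G -> u \in U ->
    c g u + (a && E g)%:Z = vsign (~~ E g) * b (stau g u) - b u.
Proof.
move=> GW [oddU stU sgU fxU] cM; have GW' g : g \in G -> g \in WB M by move/(subsetP GW).
have /card_gt0P[u0 u0U] : (0 < #|U|)%N by case: #|U| oddU.
have EM : {in G &, forall g h, E (g * h)%g = E g (+) E h}.
  by move=> g h gG hG; rewrite -!(sgU _ u0) ?groupM // snegM ?GW' // (sgU h) ?stU ?sgU.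
pose A := [set x : 'I_M * bool | x.1 \in U].
have sG g x : g \in G -> g (sflip x) = sflip (g x).
  by case: x => u s gG; rewrite /sflip !WB_act ?GW' //= addNb.
have AG g x : g \in G -> x \in A -> g x \in A.
  by case: x => u s gG; rewrite !inE WB_act ?GW' //=; apply: stU.
have AE g x : g \in G -> x \in A -> g x = sflip x -> stau g x.1 = x.1 /\ E g.
  case: x => u s gG; rewrite inE /= WB_act ?GW' // => uU [-> ]; rewrite (sgU g) //.
  by case: s; case: (E g).
have Au g x y : g \in G -> x \in A -> y \in A -> g x = sflip x -> g y = sflip y ->
    y = x \/ y = sflip x.
  move=> gG xA yA gx gy; have [fx Eg] := AE _ _ gG xA gx; have [fy _] := AE _ _ gG yA gy.
  move: xA yA; rewrite !inE => xU yU; have := fxU g _ _ gG Eg xU yU fx fy.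
  case: x y {gx gy fx fy xU yU} => u s [v t] /= ->; rewrite /sflip /=.
  by case: s; case: t; auto.
have one_orbit := flipped_one_orbit EM (@sflipK M) sG AG
  (fun g x gG xA gx => (AE g x gG xA gx).2) Au.
have cM' := signed_cocycle_ext GW cM.
have [b0 b0E] := cocycle_cobound cM'.
(* The parity at a flipped symbol is that of the defect of [b0], which does not involve [g] and, by
   [parG], is constant on orbits. *)
have par g x : g \in G -> g x = sflip x ->
    parity (signed_ext c g x) = parity (b0 x + b0 (sflip x)).
  move=> gG gx; rewrite (flip_cobound_even b0E gG gx) [in RHS]parityD mulr2n parityD.
  by rewrite F2_double add0r.
have parG g x : g \in G ->
    parity (b0 (g x) + b0 (sflip (g x))) = parity (b0 x + b0 (sflip x)).
  move=> gG; rewrite -sG //; have := b0E g x gG; have := b0E g (sflip x) gG.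
  have -> : signed_ext c g (sflip x) = - signed_ext c g x.
    by rewrite /signed_ext /=; case: x.2; rewrite !(mulN1r, mul1r, opprK).
  by move=> e1 e2; congr parity; lia.
have [a aP] : exists a : bool, forall g x, g \in G -> x \in A -> g x = sflip x ->
    parity (signed_ext c g x) = a%:R.
  case: (pickP [pred gx : {perm 'I_M * bool} * ('I_M * bool) |
      [&& gx.1 \in G, gx.2 \in A & gx.1 gx.2 == sflip gx.2]]) => [[g x] | no].
    move=> /and3P[/= gG xA /eqP gx].
    exists (parity (signed_ext c g x) != 0) => g' y g'G yA g'y.
    have /orbitP[k kG yE] := one_orbit _ _ _ _ gG g'G xA yA gx g'y.
    rewrite (par g' y) // -yE /= /aperm parG // -(par g x) //.
    by case: (parity _) => [[|[|//]] ?]; exact: val_inj.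
  exists false => g x gG xA gx.
  by have := no (g, x); rewrite /= gG xA gx eqxx.
exists a.
pose c' (g : {perm 'I_M * bool}) (x : 'I_M * bool) :=
  signed_ext c g x + vsign x.2 * (a && sneg g x.1)%:Z.
(* The integer-valued [E] is itself a signed cocycle, since exclusive or satisfies
   [x (+) y = x + (1 - 2 x) y]. *)
have c'M : perm_cocycle G c'.
  move=> g h [u s] gG hG; rewrite /c' cM' // WB_act ?GW' //= snegM ?GW' //.
  rewrite addrACA; congr (_ + _).
  by case: a {aP c'}; case: s; case: (sneg g u); case: sneg.
have [|g x gG xA gx|b [bs bE]] := odd_cobound (A := mem A) c'M (@sflipK M) sG.
- move=> g [u s] gG; rewrite /c' /signed_ext /= opprD -!mulNr.
  by case: s; rewrite /= ?opprK.
- rewrite parity_even /c' parityD aP //; have [_ Eg] := AE g x gG xA gx.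
  have xU : x.1 \in U by rewrite inE in xA.
  rewrite sgU // Eg andbT; case: x.2; rewrite ?mul1r ?mulN1r ?parityN parity_nat;
  by case: a {aP c' c'M}; rewrite ?F2_double ?addr0.
exists (fun u => b (u, true)) => g u gG uU.
have := bE g (u, true) gG; rewrite /c' /signed_ext /= !mul1r sgU // => ->.
rewrite WB_act ?GW' // sgU //; congr (_ - _); case: (E g) => /=; last by rewrite mul1r.
rewrite mulN1r -bs ?inE ?stU //.
Qed.

(** * The H1 condition *)

Definition ixm1 (M : nat) : 'I_(2 + M) := lshift M ord0.
Definition ix0 (M : nat) : 'I_(2 + M) := lshift M ord_max.

Lemma lattice_vectorP (M : nat) (x y : 'cV[int]_(2 + M)) :
  x (ixm1 M) 0 = y (ixm1 M) 0 -> x (ix0 M) 0 = y (ix0 M) 0 ->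
  (forall u, x (rshift 2 u) 0 = y (rshift 2 u) 0) -> x = y.
Proof.
move=> em1 e0 eu; apply/matrixP=> i j; rewrite (ord1 j) {j}.
case: (split_ordP i) => [k -> | u ->]; last exact: eu.
by have [->|->] : k = ord0 \/ k = ord_max;
   [case: k => [[|[|//]] ?]; [left|right]; apply: val_inj | |].
Qed.

Lemma Phi_sumE (M : nat) (g : {perm 'I_M * bool}) (x : 'cV[int]_(2 + M)) i :
  (Phi g *m x) i 0 = Phi_entry g i (ixm1 M) * x (ixm1 M) 0
    + Phi_entry g i (ix0 M) * x (ix0 M) 0
    + \sum_v Phi_entry g i (rshift 2 v) * x (rshift 2 v) 0.
Proof.
rewrite mxE big_split_ord big_ord_recr /= big_ord1 !mxE.
congr (_ * _ + _ + _); last by apply: eq_bigr => v _; rewrite mxE.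
  by congr Phi_entry; apply: val_inj.
by congr (x _ _); apply: val_inj.
Qed.

Lemma Phi_m1 (M : nat) (g : {perm 'I_M * bool}) (x : 'cV[int]_(2 + M)) :
  (Phi g *m x) (ixm1 M) 0 = x (ixm1 M) 0.
Proof.
rewrite Phi_sumE /Phi_entry !(unsplitK (inl _)) /= mul1r mul0r addr0.
by rewrite big1 ?addr0 // => v _; rewrite (unsplitK (inr _)) mul0r.
Qed.

Lemma Phi_0 (M : nat) (g : {perm 'I_M * bool}) (x : 'cV[int]_(2 + M)) :
  (Phi g *m x) (ix0 M) 0 = (snum g)./2%:Z * x (ixm1 M) 0 + x (ix0 M) 0
    + \sum_(u | sneg g u) x (rshift 2 (stau g u)) 0.
Proof.
rewrite Phi_sumE /Phi_entry !(unsplitK (inl _)) /= mul1r; congr (_ + _).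
(* Grouping the sign-changed [u] by their image [v] recovers the counting entries of the [l_0]
   row. *)
rewrite [RHS](partition_big (stau g) xpredT) //=; apply: eq_bigr => v _.
rewrite (unsplitK (inr _)) (eq_bigr (fun=> x (rshift 2 v) 0)); last first.
  by move=> u /andP[_ /eqP->].
rewrite sumr_const -mulr_natl natz; congr (_%:Z * _).
by apply: eq_card => u; rewrite !inE andbC.
Qed.

Lemma Phi_u (M : nat) (g : {perm 'I_M * bool}) (x : 'cV[int]_(2 + M)) u :
  (Phi g *m x) (rshift 2 u) 0 =
    vsign (~~ sneg g u) * x (rshift 2 (stau g u)) 0 - (sneg g u)%:Z * x (ixm1 M) 0.
Proof.
rewrite Phi_sumE /Phi_entry !(unsplitK (inl _)) (unsplitK (inr _)) /= mul0r addr0.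
rewrite addrC mulNr; congr (_ - _).
rewrite (bigD1 (stau g u)) //= big1 ?addr0 => [|v /negPf nv].
  by rewrite (unsplitK (inr _)) eqxx; case: sneg.
by rewrite (unsplitK (inr _)) eq_sym nv mul0r.
Qed.

Lemma sum_stau (M : nat) (g : {perm 'I_M * bool}) (x : 'I_M -> int) :
  g \in WB M -> \sum_u x (stau g u) = \sum_u x u.
Proof. by move=> gW; rewrite [RHS](reindex_inj (stau_inj gW)). Qed.

Lemma snumE (M : nat) (g : {perm 'I_M * bool}) : snum g = (\sum_u sneg g u)%N.
Proof. by rewrite /snum -sum1dep_card big_mkcond; apply: eq_bigr => u _; case: sneg. Qed.

Lemma sum_vsign (M : nat) (g : {perm 'I_M * bool}) (x : 'I_M -> int) :
  \sum_u vsign (~~ sneg g u) * x u = \sum_u x u - (\sum_(u | sneg g u) x u) *+ 2.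
Proof.
rewrite [in RHS](bigID (sneg g)) [LHS](bigID (sneg g)) /= mulr2n.
have -> : \sum_(u | sneg g u) vsign (~~ sneg g u) * x u = - \sum_(u | sneg g u) x u.
  by rewrite -sumrN; apply: eq_bigr => u ->; rewrite mulN1r.
have -> : \sum_(u | ~~ sneg g u) vsign (~~ sneg g u) * x u = \sum_(u | ~~ sneg g u) x u.
  by apply: eq_bigr => u ->; rewrite mul1r.
by rewrite opprD [in RHS]addrACA subrr add0r addrC.
Qed.

(** On vectors with zero [l_{-1}] coordinate the linear form [2 x_0 + \sum_u x_u] is invariant under
    [Phi g]. Hence it turns the cocycle into a homomorphism to the integers, as does the [l_{-1}]
    coordinate, and both vanish. *)
Lemma lattice_cocycle (M : nat) (G : {group {perm 'I_M * bool}})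
    (f : {perm 'I_M * bool} -> 'cV[int]_(2 + M)) :
  G \subset WB M ->
  (forall g h, g \in G -> h \in G -> f (g * h)%g = f g + Phi g *m f h) ->
  [/\ {in G, forall g, f g (ixm1 M) 0 = 0},
      signed_cocycle G (fun g u => f g (rshift 2 u) 0) &
      {in G, forall g, f g (ix0 M) 0 *+ 2 + \sum_u f g (rshift 2 u) 0 = 0}].
Proof.
move=> /subsetP GW fM; have fm1 : {in G, forall g, f g (ixm1 M) 0 = 0}.
  by apply: group_hom_int0 => g h gG hG; rewrite fM // mxE Phi_m1.
have fu : signed_cocycle G (fun g u => f g (rshift 2 u) 0).
  by move=> g h u gG hG; rewrite fM // mxE Phi_u fm1 // mulr0 subr0.
split=> //; apply: group_hom_int0 => g h gG hG.
rewrite (eq_bigr _ (fun u _ => fu g h u gG hG)) big_split /=.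
rewrite sum_vsign (sum_stau (fun u => f h (rshift 2 u) 0) (GW _ gG)).
rewrite fM // mxE Phi_0 fm1 // mulr0 add0r.
by set s1 : int := \sum_(i < M) _; set s2 : int := \sum_(i < M) _;
  set s3 : int := \sum_(u | _) _; ring.
Qed.

(** Summed over [U], the coboundary is [0] or [-2 \sum b], hence even, while the correction term is
    counted [#|U|] times, an odd number. *)
Lemma block_parity (M : nat) (G : {group {perm 'I_M * bool}}) U E
    (c : {perm 'I_M * bool} -> 'I_M -> int) (a : bool) (b : 'I_M -> int) g :
  G \subset WB M -> sign_block G U E -> g \in G ->
  (forall u, u \in U ->
     c g u + (a && E g)%:Z = vsign (~~ E g) * b (stau g u) - b u) ->
  parity (\sum_(u in U) c g u) = (a && E g)%:R.
Proof.
move=> /subsetP GW [oddU stU _ _] gG cE.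
have memU u : (stau g u \in U) = (u \in U).
  apply/idP/idP=> uU; last exact: stU.
  by rewrite -[u]stau1 -(mulgV g) stauM ?GW ?groupV // stU ?groupV.
have sumU : \sum_(u in U) b (stau g u) = \sum_(u in U) b u.
  rewrite [RHS](reindex_inj (stau_inj (GW g gG))).
  by apply: eq_bigl => u; rewrite memU.
have -> : \sum_(u in U) c g u =
    vsign (~~ E g) * (\sum_(u in U) b u) - \sum_(u in U) b u - (a && E g)%:Z *+ #|U|.
  rewrite -[in X in _ * X - _]sumU mulr_sumr -sumrB -sumr_const -sumrB.
  by apply: eq_bigr => u uU; rewrite -cE // addrK.
set s : int := \sum_(u in U) b u.
have -> : vsign (~~ E g) * s - s = (E g)%:Z * (- s) *+ 2
  by rewrite /vsign; case: (E g) => /=; ring.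
rewrite mulr2n -[_ *+ #|U|]mulr_natr parityD parityN parityD F2_double add0r.
by rewrite natz -PoszM parity_nat oddM oddU andbT; case: (_ && _).
Qed.

(** Where [a] holds, [y] is true an even positive number of times, and where [a] fails so is [x].
    This would require at least four indices. *)
Lemma three_characters (a x y : 'I_3 -> bool) i j :
  x i -> y j -> ~~ a i -> a j ->
  ~~ odd (\sum_i (a i && y i)) -> ~~ odd (\sum_i (a i && x i)) ->
  ~~ odd (\sum_i y i) -> ~~ odd (\sum_i x i) -> False.
Proof.
rewrite !big_ord_recr !big_ord0 /=.
set i0 := widen_ord _ (widen_ord _ _); set i1 := widen_ord _ ord_max.
have iE (k : 'I_3) : [\/ k = i0, k = i1 | k = ord_max].
  by case: k => [[|[|[|//]]] ?];
    [apply: Or31|apply: Or32|apply: Or33]; apply: val_inj.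
case: (iE i) => ->; case: (iE j) => ->;
  case: (a i0); case: (a i1); case: (a ord_max);
  case: (x i0); case: (x i1); case: (x ord_max);
  case: (y i0); case: (y i1); case: (y ord_max) => //.
Qed.

Lemma coboundary_of_blocks (M : nat) (G : {group {perm 'I_M * bool}})
    (k : 'I_M -> 'I_3) (E : 'I_3 -> {perm 'I_M * bool} -> bool) c :
  G \subset WB M ->
  (forall i, sign_block G [set u | k u == i] (E i)) ->
  (forall g, g \in G -> ~~ odd (\sum_i E i g)) ->
  signed_cocycle G c ->
  (forall g, g \in G -> (2 %| \sum_u c g u)%Z) ->
  exists (a : bool) (b : 'I_M -> int), forall g u, g \in G ->
    c g u + (a && sneg g u)%:Z = vsign (~~ sneg g u) * b (stau g u) - b u.
Proof.
move=> GW blk Esum cM even_c.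
have [a /fin_all_exists[b cE]] := fin_all_exists (fun i => block_cobound GW (blk i) cM).
(* The evenness of the total sum, read block by block through [block_parity], becomes a linear
   relation between the characters. *)
have aE g : g \in G -> ~~ odd (\sum_i (a i && E i g)).
  move=> gG; have := even_c g gG; rewrite parity_even.
  rewrite (partition_big k xpredT) //= (big_morph parity parityD (erefl _)).
  under eq_bigr => i _.
    under eq_bigl => u do rewrite -(in_set (fun u => k u == i)).
    rewrite (block_parity (a := a i) (b := b i) GW (blk i) gG); last first.
      by move=> u uU; apply: cE.
    over.
  by rewrite -natr_sum -[_%:R]/(parity (Posz _)) parity_nat; case: odd.
have sgE g u : g \in G -> sneg g u = E (k u) g.
  by move=> gG; have [_ _ sgU _] := blk (k u); rewrite (sgU g u) // inE.
(* The common value is 0 if some block with [a i = 0] has a nontrivial character, and 1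
   otherwise. *)
have [a0 a0P] : exists a0, forall i g, g \in G -> E i g -> a i = a0.
  case: (pickP [pred ig : 'I_3 * {perm 'I_M * bool} |
      [&& ~~ a ig.1, ig.2 \in G & E ig.1 ig.2]]) => [[i g] /and3P[/= ai gG Eg]|no].
    exists false => j h hG Eh; apply/negbTE/negP => aj.
    have := Esum g gG; have := Esum h hG; have := aE g gG; have := aE h hG.
    exact: three_characters Eg Eh ai aj.
  exists true => i g gG Eg; have := no (i, g).
  by rewrite /= gG Eg !andbT => /negbFE.
exists a0, (fun u => b (k u) u) => g u gG.
have kst : k (stau g u) = k u.
  have [_ stU _ _] := blk (k u); have := stU g u gG.
  by rewrite !inE eqxx => /(_ isT)/eqP.
rewrite sgE // kst -cE ?inE //; congr (_ + _%:Z).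
by case Eg: (E _ _); rewrite ?andbF // (a0P _ _ gG Eg).
Qed.

Theorem condH1_of_blocks (M : nat) (H : {group {perm 'I_M * bool}})
    (k : 'I_M -> 'I_3) (E : 'I_3 -> {perm 'I_M * bool} -> bool) :
  H \subset WD M ->
  (forall i, sign_block H [set u | k u == i] (E i)) ->
  (forall g, g \in H -> ~~ odd (\sum_i E i g)) ->
  condH1 H.
Proof.
move=> HW blk Esum G GH f fM.
have GWD g : g \in G -> g \in WB M /\ ~~ odd (snum g).
  by move=> gG; have := subsetP HW g (subsetP GH g gG); rewrite !inE => /andP[].
have GW : G \subset WB M by apply/subsetP=> g /GWD[].
have [fm1 fu f0] := lattice_cocycle GW fM.
have even_f g : g \in G -> (2 %| \sum_u f g (rshift 2 u) 0)%Z.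
  by move=> gG; have := f0 g gG; lia.
have Esum' g : g \in G -> ~~ odd (\sum_i E i g) by move=> gG; apply: Esum; apply: (subsetP GH).
have [a [b cE]] :=
  coboundary_of_blocks GW (fun i => sign_blockS GH (blk i)) Esum' fu even_f.
(* The coefficient [a] of [l_{-1}] produces the correction [a && sneg g u]. Since [l_0] is fixed,
   its coefficient does not affect the coboundary and is set to 0. *)
pose v : 'cV[int]_(2 + M) := \col_i
  match split i with inl j => if (j : nat) == 0%N then (a : nat)%:Z else 0 | inr u => b u end.
have vm1 : v (ixm1 M) 0 = a%:Z by rewrite mxE (unsplitK (inl _)).
have v0 : v (ix0 M) 0 = 0 by rewrite mxE (unsplitK (inl _)).
have vu u : v (rshift 2 u) 0 = b u by rewrite mxE (unsplitK (inr _)).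
exists v => g gG; have [gW even_g] := GWD g gG.
have subE i : (Phi g *m v - v) i 0 = (Phi g *m v) i 0 - v i 0.
  by rewrite mxE; congr (_ + _); rewrite mxE.
have fuE u : f g (rshift 2 u) 0 =
    vsign (~~ sneg g u) * b (stau g u) - b u - (a && sneg g u)%:Z.
  by rewrite -cE // addrK.
apply: lattice_vectorP => [||u]; rewrite subE.
- by rewrite Phi_m1 subrr fm1.
- rewrite Phi_0 vm1 v0 addr0 subr0.
  under eq_bigr => u _ do rewrite vu.
  (* The [l_0] coordinate is forced by the relation [f0]; it is compared after doubling, where
     [(snum g)./2] is exact because [snum g] is even. *)
  have := f0 g gG; rewrite (eq_bigr _ (fun u _ => fuE u)).
  rewrite !sumrB sum_vsign (sum_stau b gW).
  have -> : \sum_u (a && sneg g u)%:Z = (a : nat)%:Z * (snum g)./2%:Z *+ 2.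
    have -> : (a : nat)%:Z * (snum g)./2%:Z *+ 2 = ((a * snum g)%N)%:Z.
      by have := even_g; case: (a); lia.
    rewrite snumE big_distrr /= (big_morph Posz PoszD (erefl _)).
    by apply: eq_bigr => u _; case: (a); case: sneg.
  set s : int := \sum_(i < M) _; set t : int := \sum_(u | _) _.
  by set w := Posz _; set w' := Posz _; lia.
rewrite Phi_u !vu vm1 fuE addrAC; congr (_ - _ - _).
by case: (a); case: sneg.
Qed.

(** * Relative minimality *)

Lemma vl0E (M : nat) :
  [/\ vl0 M (ixm1 M) 0 = 0, vl0 M (ix0 M) 0 = 1 & forall u, vl0 M (rshift 2 u) 0 = 0].
Proof. by split=> [||u]; rewrite mxE ?(unsplitK (inl _)) ?(unsplitK (inr _)). Qed.

Lemma vKE (M : nat) :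
  [/\ vK M (ixm1 M) 0 = -2, vK M (ix0 M) 0 = -2 & forall u, vK M (rshift 2 u) 0 = 1].
Proof. by split=> [||u]; rewrite mxE ?(unsplitK (inl _)) ?(unsplitK (inr _)). Qed.

Lemma Phi_vl0 (M : nat) (g : {perm 'I_M * bool}) : Phi g *m vl0 M = vl0 M.
Proof.
have [em1 e0 eu] := vl0E M; apply: lattice_vectorP => [||u].
- by rewrite Phi_m1.
- by rewrite Phi_0 em1 mulr0 add0r big1 ?addr0.
by rewrite Phi_u !eu em1 !mulr0 subrr.
Qed.

Lemma Phi_vK (M : nat) (g : {perm 'I_M * bool}) :
  ~~ odd (snum g) -> Phi g *m vK M = vK M.
Proof.
have [em1 e0 eu] := vKE M; move=> even_g; apply: lattice_vectorP => [||u].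
- by rewrite Phi_m1.
- rewrite Phi_0 em1 e0 (eq_bigr (fun=> 1%:Z)); last by move=> u _; rewrite eu.
  have -> : \sum_(u | sneg g u) 1%:Z = (snum g)%:Z.
    by rewrite sumr_const /snum cardsE -[RHS]natz.
  by move: even_g; lia.
by rewrite Phi_u !eu em1; case: sneg.
Qed.

(* In terms of [d u = 2 x_u + x_{-1}] the twisted action of [Phi] on the
   coordinates of [x] becomes a plain signed permutation. *)
Lemma Phi_inv_signed (M : nat) (g : {perm 'I_M * bool}) (x : 'cV[int]_(2 + M)) u :
  Phi g *m x = x ->
  let d u := x (rshift 2 u) 0 *+ 2 + x (ixm1 M) 0 in
  d u = vsign (~~ sneg g u) * d (stau g u).
Proof.
move=> gx /=; have := Phi_u g x u; rewrite gx => ->.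
by case: sneg => /=; ring.
Qed.

(** If [2 x_u + x_{-1}] vanishes for every [u], all [x_u] equal one constant [t] and
    [x_{-1} = -2 t], which leaves only [t] and [x_0] free. *)
Theorem rel_minimal_of_signed (M' : nat) (H : {set {perm 'I_M'.+1 * bool}}) :
  H \subset WD M'.+1 ->
  (forall d : 'I_M'.+1 -> int,
     (forall g u, g \in H -> d u = vsign (~~ sneg g u) * d (stau g u)) ->
     forall u, d u = 0) ->
  rel_minimal H.
Proof.
move=> HW dH x; split=> [xinv | [a [b ->]] g gH]; last first.
  have := subsetP HW g gH; rewrite inE => /andP[_ even_g].
  by rewrite mulmxDr -!scalemxAr Phi_vl0 Phi_vK.
have d0 := dH _ (fun g u gH => Phi_inv_signed u (xinv g gH)).
have xm1 : x (ixm1 M'.+1) 0 = - (x (rshift 2 ord0) 0 *+ 2).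
  by apply/eqP; rewrite -addr_eq0 addrC; apply/eqP/d0.
have xu u : x (rshift 2 u) 0 = x (rshift 2 ord0) 0.
  by have := d0 u; rewrite xm1; lia.
(* The multiple of [K] is read off at any [l_u]; the coefficient of [l_0] compensates the entry -2
   of [K]. *)
exists (x (ix0 M'.+1) 0 + x (rshift 2 ord0) 0 *+ 2), (x (rshift 2 ord0) 0).
have [lm1 l0 lu] := vl0E M'.+1; have [km1 k0 ku] := vKE M'.+1.
have combE (a b : int) i : (a *: vl0 M'.+1 + b *: vK M'.+1) i 0
    = a * vl0 M'.+1 i 0 + b * vK M'.+1 i 0 by rewrite !mxE.
by apply: lattice_vectorP => [||u]; rewrite combE
  ?lm1 ?l0 ?lu ?km1 ?k0 ?ku ?xm1 ?xu; ring.
Qed.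

(** * Products of affine groups *)

(* [phi k] is the point with label [k], and the permutations [t1], [t2] of the
   labels are [x |-> m x] and [x |-> x + e].  Since for F_q the points are
   reduced polynomials inside the larger group [{poly 'F_p}], the injectivity
   conditions on [m] only concern differences of points. *)
Record affine_labelling (N : nat) (V : zmodType) (phi : nat -> V) (m : V -> V)
    (e : V) (t1 t2 : nat -> nat) : Prop := AffineLabelling {
  al_odd : odd N;
  al_inj : forall j k, (0 < j <= N)%N -> (0 < k <= N)%N -> phi j = phi k -> j = k;
  al_add : {morph m : x y / x + y};
  al_range1 : forall k, (0 < k <= N)%N -> (0 < t1 k <= N)%N;
  al_range2 : forall k, (0 < k <= N)%N -> (0 < t2 k <= N)%N;
  al_t1 : forall k, (0 < k <= N)%N -> phi (t1 k) = m (phi k);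
  al_t2 : forall k, (0 < k <= N)%N -> phi (t2 k) = phi k + e;
  al_ker : forall j k, (0 < j <= N)%N -> (0 < k <= N)%N ->
    m (phi j - phi k) = 0 -> j = k;
  al_fix : forall n j k, odd n -> (0 < j <= N)%N -> (0 < k <= N)%N ->
    iter n m (phi j - phi k) = phi j - phi k -> j = k;
  al_ind : forall Q : nat -> Prop,
    (forall k, (0 < k <= N)%N -> phi k = 0 -> Q k) ->
    (forall k, (0 < k <= N)%N -> Q k -> Q (t1 k)) ->
    (forall k, (0 < k <= N)%N -> Q k -> Q (t2 k)) ->
    forall k, (0 < k <= N)%N -> Q k }.

Lemma morph_add0 (V : zmodType) (m : V -> V) : {morph m : x y / x + y} -> m 0 = 0.
Proof. by move=> mD; have := mD 0 0; rewrite addr0 -[LHS]addr0 => /addrI. Qed.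

Lemma morph_addB (V : zmodType) (m : V -> V) :
  {morph m : x y / x + y} -> {morph m : x y / x - y}.
Proof. by move=> mD x y; apply: (addIr (m y)); rewrite -mD !subrK. Qed.

Lemma iter_morph (V : zmodType) (m : V -> V) n :
  {morph m : x y / x + y} -> {morph iter n m : x y / x + y}.
Proof. by move=> mD x y; elim: n => //= n ->. Qed.

Lemma al_inj1 N V phi m e t1 t2 : @affine_labelling N V phi m e t1 t2 ->
  forall j k, (0 < j <= N)%N -> (0 < k <= N)%N -> t1 j = t1 k -> j = k.
Proof.
move=> al j k jN kN /(congr1 phi); rewrite !(al_t1 al) // => /eqP.
by rewrite -subr_eq0 -(morph_addB (al_add al)) => /eqP/(al_ker al jN kN).
Qed.

Lemma al_inj2 N V phi m e t1 t2 : @affine_labelling N V phi m e t1 t2 ->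
  forall j k, (0 < j <= N)%N -> (0 < k <= N)%N -> t2 j = t2 k -> j = k.
Proof.
move=> al j k jN kN /(congr1 phi); rewrite !(al_t2 al) // => /addIr.
exact: (al_inj al).
Qed.

(** * Local generators as signed permutations *)

Section EmbeddedPermutation.
Variables (M' off N : nat) (t : nat -> nat) (fl : bool).
Hypothesis (offN : (off + N <= M')%N).
Hypothesis (t_range : forall k, (0 < k <= N)%N -> (0 < t k <= N)%N).
Hypothesis (t_inj : forall j k, (0 < j <= N)%N -> (0 < k <= N)%N -> t j = t k -> j = k).

(** Indices start at 0 and labels at 1, so the index [u] carries the local label [u.+1 - off]. *)
Definition etau (u : 'I_M'.+1) : 'I_M'.+1 :=
  if (off <= u < off + N)%N then inord (off + t (u.+1 - off)).-1 else u.

Definition eneg (u : 'I_M'.+1) : bool :=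
  if (off <= u < off + N)%N then fl else fl && (u == M' :> nat).

Let loc (u : 'I_M'.+1) : (off <= u < off + N)%N -> (0 < t (u.+1 - off) <= N)%N.
Proof. by move=> uN; apply: t_range; lia. Qed.

Lemma etau_in (u : 'I_M'.+1) : (off <= u < off + N)%N ->
  (off <= etau u < off + N)%N /\ ((etau u).+1 - off = t (u.+1 - off))%N.
Proof.
move=> uN; rewrite /etau uN; have := loc uN => tN.
by rewrite inordK; [split; lia | lia].
Qed.

Lemma etau_inj : injective etau.
Proof.
move=> u v; have [uN|uN] := boolP (off <= u < off + N)%N;
  have [vN|vN] := boolP (off <= v < off + N)%N => tE.
- apply: val_inj => /=; have [_ eu] := etau_in uN; have [_ ev] := etau_in vN.
  have : (u.+1 - off = v.+1 - off)%N by apply: t_inj; [lia|lia|rewrite -eu -ev tE].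
  lia.
- by have [] := etau_in uN; rewrite tE {1 2}/etau (negPf vN) (negPf vN).
- by have [] := etau_in vN; rewrite -tE {1 2}/etau (negPf uN) (negPf uN).
by move: tE; rewrite /etau (negPf uN) (negPf vN).
Qed.

(** The underlying map is injective, so [mkperm] returns it and not its default, the identity. *)
Lemma spermE u s :
  sperm M' (embed off N t fl M'.+1) (u, s) = (etau u, s (+) eneg u).
Proof.
pose F (x : 'I_M'.+1 * bool) := (etau x.1, x.2 (+) eneg x.1).
have FE (x : 'I_M'.+1 * bool) : (inord (embed off N t fl M'.+1 x.1.+1).1.-1,
             x.2 (+) (embed off N t fl M'.+1 x.1.+1).2) = F x.
  rewrite /F /embed /etau /eneg !ltnS eqSS; case: x => u' s' /=.
  by case: ifP => _ //=; rewrite inord_val.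
have Finj : injective F.
  by move=> [v1 s1] [v2 s2] [/etau_inj <-] /addIb <-.
rewrite /sperm /mkperm; case: injectiveP => [inj | ninj].
  by rewrite permE FE.
by case: ninj => x y; rewrite !FE => /Finj.
Qed.

Lemma sperm_WB : sperm M' (embed off N t fl M'.+1) \in WB M'.+1.
Proof. exact: WBP spermE. Qed.

Lemma stau_sperm u : stau (sperm M' (embed off N t fl M'.+1)) u = etau u.
Proof. by rewrite /stau spermE. Qed.

Lemma sneg_sperm u : sneg (sperm M' (embed off N t fl M'.+1)) u = eneg u.
Proof. by rewrite /sneg spermE /= negbK. Qed.

End EmbeddedPermutation.

(** The exponent [n] counts sign-changing generators in a word for [g]; it governs both the linear
    part [m^n] and the sign. *)
Definition affine_on (M off N : nat) (V : zmodType) (phi : nat -> V) (m : V -> V)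
    (g : {perm 'I_M * bool}) (n : nat) : Prop :=
  exists b : V, forall u : 'I_M, (off <= u < off + N)%N ->
    [/\ (off <= stau g u < off + N)%N, sneg g u = odd n &
        phi ((stau g u).+1 - off)%N = iter n m (phi (u.+1 - off)%N) + b].

Lemma affine_onM (M off N : nat) (V : zmodType) (phi : nat -> V) (m : V -> V)
    (g h : {perm 'I_M * bool}) n k :
  g \in WB M -> h \in WB M -> {morph m : x y / x + y} ->
  affine_on off N phi m g n -> affine_on off N phi m h k ->
  affine_on off N phi m (g * h)%g (k + n).
Proof.
move=> gW hW mD [b gb] [c hc]; exists (iter k m b + c) => u uN.
rewrite stauM // snegM //; have [gu -> ge] := gb u uN; have [hu -> ->] := hc _ gu.
by split=> //; rewrite ?oddD 1?addbC // iterD ge iter_morph // addrA.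
Qed.

Lemma affine_on_id (M off N : nat) (V : zmodType) (phi : nat -> V) (m : V -> V)
    (g : {perm 'I_M * bool}) :
  (forall u : 'I_M, (off <= u < off + N)%N -> stau g u = u /\ sneg g u = false) ->
  affine_on off N phi m g 0.
Proof. by move=> gE; exists 0 => u uN; have [-> ->] := gE u uN; rewrite addr0. Qed.

(** The difference of two fixed points is fixed by the linear part [m^n], which for odd [n] fixes no
    nonzero difference of points. *)
Lemma affine_on_fix (M off N : nat) (V : zmodType) (phi : nat -> V) (m : V -> V)
    e t1 t2 (g : {perm 'I_M * bool}) n (u v : 'I_M) :
  affine_labelling N phi m e t1 t2 -> affine_on off N phi m g n -> odd n ->
  (off <= u < off + N)%N -> (off <= v < off + N)%N ->
  stau g u = u -> stau g v = v -> u = v.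
Proof.
move=> al [b gb] odd_n uN vN gu gv; apply: val_inj => /=.
have [_ _] := gb u uN; have [_ _] := gb v vN; rewrite gu gv => ev eu.
have : (u.+1 - off = v.+1 - off)%N.
  apply: (al_fix al odd_n); [lia | lia |].
  rewrite (morph_addB (iter_morph n (al_add al))) [in RHS]eu [in RHS]ev.
  by rewrite opprD addrACA subrr addr0.
by lia.
Qed.

Lemma card_interval (M off N : nat) : (off + N <= M)%N ->
  #|[set u : 'I_M | (off <= u < off + N)%N]| = N.
Proof.
case: M => [|M'] offN; first by rewrite eq_card0; [lia | case].
rewrite -[RHS]card_ord -(card_imset (f := fun j : 'I_N => inord (off + j) : 'I_M'.+1) predT).
  apply: eq_card => u; rewrite inE; apply/idP/imsetP => [uN | [j _ ->]].
    have jN : (u - off < N)%N by lia.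
    by exists (Ordinal jN) => //; apply: val_inj; rewrite /= inordK; lia.
  by rewrite inordK; have := ltn_ord j; lia.
move=> i j /(congr1 val); rewrite /= !inordK; [|have := ltn_ord j; lia|have := ltn_ord i; lia].
by move/addnI/val_inj.
Qed.

Lemma gen_ind (gT : finGroupType) (A : {set gT}) (P : gT -> Prop) :
  P 1%g -> (forall x y, P x -> P y -> P (x * y)%g) ->
  (forall x, x \in A -> P x) -> forall x, x \in <<A>>%g -> P x.
Proof.
move=> P1 PM PA x /gen_prodgP[n [c cA ->]].
by elim/big_ind: _ => // i _; apply: PA.
Qed.

Section ProductOfLabellings.
Variables (N1 N2 : nat) (V1 V2 : zmodType) (phi1 : nat -> V1) (phi2 : nat -> V2).
Variables (m1 : V1 -> V1) (m2 : V2 -> V2) (e1 : V1) (e2 : V2).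
Variables (t1 t2 t1' t2' : nat -> nat).
Hypothesis al1 : affine_labelling N1 phi1 m1 e1 t1 t2.
Hypothesis al2 : affine_labelling N2 phi2 m2 e2 t1' t2'.

Local Notation M' := (N1 + N2)%N.
Local Notation H := <<gens N1 N2 t1 t2 t1' t2'>>%g.

Let off1 : (0 + N1 <= M')%N. Proof. exact: leq_addr. Qed.
Let off2 : (N1 + N2 <= M')%N. Proof. by []. Qed.

(** Both sign-changing generators also change the sign at the common index, where the character is
    therefore the product of those of the two blocks. *)
Definition affine_elt (g : {perm 'I_M'.+1 * bool}) : Prop :=
  g \in WB M'.+1 /\ exists n1 n2 : nat,
    [/\ affine_on 0 N1 phi1 m1 g n1, affine_on N1 N2 phi2 m2 g n2 &
        forall u : 'I_M'.+1, u = M' :> nat -> stau g u = u /\ sneg g u = odd (n1 + n2)].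

Lemma affine_gen off N (V : zmodType) (phi : nat -> V) (m : V -> V) (e : V) s1 s2 :
  affine_labelling N phi m e s1 s2 -> (off + N <= M')%N ->
  affine_on off N phi m (sperm M' (embed off N s1 true M'.+1)) 1 /\
  affine_on off N phi m (sperm M' (embed off N s2 false M'.+1)) 0.
Proof.
move=> al offN; split.
  have S1 := al_range1 al; have I1 := al_inj1 al.
  exists 0 => u uN; rewrite stau_sperm // sneg_sperm //.
  have [-> ->] := etau_in offN S1 uN.
  by rewrite /eneg uN (al_t1 al) ?addr0 //; lia.
have S2 := al_range2 al; have I2 := al_inj2 al.
exists e => u uN; rewrite stau_sperm // sneg_sperm //.
have [-> ->] := etau_in offN S2 uN.
by rewrite /eneg uN (al_t2 al) //; lia.
Qed.

Lemma affine_gen_other off N off' N' (V : zmodType) (phi : nat -> V) (m : V -> V) s fl :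
  (off + N <= M')%N ->
  (forall k, (0 < k <= N)%N -> (0 < s k <= N)%N) ->
  (forall j k, (0 < j <= N)%N -> (0 < k <= N)%N -> s j = s k -> j = k) ->
  (off' + N' <= M')%N -> (off + N <= off')%N || (off' + N' <= off)%N ->
  affine_on off' N' phi m (sperm M' (embed off N s fl M'.+1)) 0.
Proof.
move=> offN sr si offN' dis; apply: affine_on_id => u uN'.
have uN : (off <= u < off + N)%N = false by move: dis uN'; lia.
rewrite stau_sperm // sneg_sperm // /etau /eneg uN; split=> //.
by apply/andP => -[_ /eqP]; lia.
Qed.

Lemma star_gen off N s fl (u : 'I_M'.+1) :
  (off + N <= M')%N ->
  (forall k, (0 < k <= N)%N -> (0 < s k <= N)%N) ->
  (forall j k, (0 < j <= N)%N -> (0 < k <= N)%N -> s j = s k -> j = k) ->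
  u = M' :> nat ->
  stau (sperm M' (embed off N s fl M'.+1)) u = u /\
  sneg (sperm M' (embed off N s fl M'.+1)) u = fl.
Proof.
move=> offN sr si uM; have uN : (off <= u < off + N)%N = false by lia.
by rewrite stau_sperm // sneg_sperm // /etau /eneg uN uM eqxx andbT.
Qed.

Lemma affine_elt_gen g : g \in H -> affine_elt g.
Proof.
move: g; apply: gen_ind => [|g h [gW [n1 [n2 [g1 g2 gs]]]] [hW [k1 [k2 [h1 h2 hs]]]]|g].
- split; first exact: group1.
  have id1 (u : 'I_M'.+1) : stau 1%g u = u /\ sneg 1%g u = false.
    by rewrite stau1 /sneg perm1.
  by exists 0%N, 0%N; split=> [||u _]; [apply: affine_on_id => u _ ..|]; exact: id1.
- split; first exact: groupM.
  exists (k1 + n1)%N, (k2 + n2)%N; split; [exact: (affine_onM _ _ (al_add al1))|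
     exact: (affine_onM _ _ (al_add al2)) |] => u uM.
  have [gu ge] := gs u uM; have [hu he] := hs u uM.
  rewrite stauM // snegM // gu hu ge he; split=> //.
  by rewrite -oddD; congr odd; lia.
have [a1 a2] := affine_gen al1 off1; have [b1 b2] := affine_gen al2 off2.
have R1 := al_range1 al1; have R2 := al_range2 al1.
have R1' := al_range1 al2; have R2' := al_range2 al2.
have I1 := al_inj1 al1; have I2 := al_inj2 al1.
have I1' := al_inj1 al2; have I2' := al_inj2 al2.
rewrite /gens !inE -!orbA => /or4P[] /eqP ->; (split; first by apply: sperm_WB);
  [exists 1%N, 0%N | exists 0%N, 0%N | exists 0%N, 1%N | exists 0%N, 0%N];
  (split=> [||u uM]; [ | | exact: star_gen]) => //;
  by apply: affine_gen_other => //; rewrite ?add0n ?leqnn ?orbT.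
Qed.

Definition block_of (u : 'I_M'.+1) : 'I_3 :=
  if (u < N1)%N then ord0 else if (u < M')%N then inord 1 else ord_max.

(** The sign is read at one index per block: the first of each of the two factors, and the common
    one. *)
Definition block_sign (i : 'I_3) (g : {perm 'I_M'.+1 * bool}) : bool :=
  sneg g (if i == ord0 then ord0 else if i == ord_max then ord_max else inord N1).

Let N1_gt0 : (0 < N1)%N. Proof. exact: odd_gt0 (al_odd al1). Qed.
Let N2_gt0 : (0 < N2)%N. Proof. exact: odd_gt0 (al_odd al2). Qed.

Lemma block_ofE (u : 'I_M'.+1) :
  [/\ (block_of u == ord0) = (0 <= u < 0 + N1)%N,
      (block_of u == inord 1) = (N1 <= u < N1 + N2)%N &
      (block_of u == ord_max) = (u == M' :> nat)].
Proof.
have := ltn_ord u; rewrite /block_of -!val_eqE /=.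
case: ifP => [lt1 _ | /negbT ge1]; last case: ifP => [lt2 _ | /negbT ge2 lt3];
  by rewrite /= ?inordK //=; split; lia.
Qed.

Lemma block_signE g n1 n2 :
  affine_on 0 N1 phi1 m1 g n1 -> affine_on N1 N2 phi2 m2 g n2 ->
  (forall u : 'I_M'.+1, u = M' :> nat -> stau g u = u /\ sneg g u = odd (n1 + n2)) ->
  [/\ block_sign ord0 g = odd n1, block_sign (inord 1) g = odd n2 &
      block_sign ord_max g = odd (n1 + n2)].
Proof.
move=> [b1 a1] [b2 a2] as_; rewrite /block_sign -!val_eqE /= inordK //=; split.
- by have [|_ -> _] := a1 ord0; first by rewrite /=; lia.
- by have [|_ -> _] := a2 (inord N1); first by rewrite inordK; lia.
by have [|_ ->] := as_ ord_max.
Qed.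

Lemma I3P (i : 'I_3) : [\/ i = ord0, i = inord 1 | i = ord_max].
Proof.
by case: i => [[|[|[|//]]] ?]; [apply: Or31|apply: Or32|apply: Or33];
  apply: val_inj; rewrite //= inordK.
Qed.

Lemma sum_block_sign g : g \in H -> ~~ odd (\sum_i block_sign i g).
Proof.
move=> /affine_elt_gen[_ [n1 [n2 [g1 g2 gs]]]].
have [s1 s2 s3] := block_signE g1 g2 gs.
rewrite !big_ord_recr big_ord0 /= add0n.
rewrite (_ : widen_ord _ (widen_ord _ _) = ord0); last exact: val_inj.
rewrite (_ : widen_ord _ _ = inord 1); last by apply: val_inj; rewrite /= inordK.
by rewrite s1 s2 s3 !oddD !oddb addbb.
Qed.

Lemma sign_block_block_of i : sign_block H [set u | block_of u == i] (block_sign i).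
Proof.
case: (I3P i) => {i}->.
- rewrite (_ : [set u | _] = [set u : 'I_M'.+1 | (0 <= u < 0 + N1)%N]); last first.
    by apply/setP=> u; rewrite !inE; have [->] := block_ofE u.
  split=> [|g u gH|g u gH|g u v gH]; rewrite ?inE.
  + by rewrite card_interval; [exact: al_odd al1 | lia].
  + by move=> uN; have [_ [n1 [n2 [[b gb] _ _]]]] := affine_elt_gen gH; have [] := gb u uN.
  + move=> uN; have [_ [n1 [n2 [g1 g2 gs]]]] := affine_elt_gen gH.
    by have [-> _ _] := block_signE g1 g2 gs; case: g1 => b /(_ u uN)[].
  have [_ [n1 [n2 [g1 g2 gs]]]] := affine_elt_gen gH.
  by have [-> _ _] := block_signE g1 g2 gs; exact: (affine_on_fix al1 g1).
- rewrite (_ : [set u | _] = [set u : 'I_M'.+1 | (N1 <= u < N1 + N2)%N]); last first.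
    by apply/setP=> u; rewrite !inE; have [_ ->] := block_ofE u.
  split=> [|g u gH|g u gH|g u v gH]; rewrite ?inE.
  + by rewrite card_interval; [exact: al_odd al2 | lia].
  + by move=> uN; have [_ [n1 [n2 [_ [b gb] _]]]] := affine_elt_gen gH; have [] := gb u uN.
  + move=> uN; have [_ [n1 [n2 [g1 g2 gs]]]] := affine_elt_gen gH.
    by have [_ -> _] := block_signE g1 g2 gs; case: g2 => b /(_ u uN)[].
  have [_ [n1 [n2 [g1 g2 gs]]]] := affine_elt_gen gH.
  by have [_ -> _] := block_signE g1 g2 gs; exact: (affine_on_fix al2 g2).
rewrite (_ : [set u | _] = [set ord_max]); last first.
  by apply/setP=> u; rewrite !inE; have [_ _ ->] := block_ofE u.
split=> [|g u gH|g u gH|g u v gH]; rewrite ?cards1 ?inE //.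
- move/eqP->; have [_ [n1 [n2 [_ _ gs]]]] := affine_elt_gen gH.
  by have [|->] := gs ord_max.
- by move/eqP->; rewrite /block_sign -!val_eqE.
by move=> _ /eqP-> /eqP->.
Qed.

(** All blocks have odd size, so modulo 2 the number of sign changes is the sum of the three block
    signs. *)
Lemma gen_WD : H \subset WD M'.+1.
Proof.
apply/subsetP=> g gH; have [gW _] := affine_elt_gen gH; rewrite inE gW /=.
have := sum_block_sign gH; rewrite snumE (partition_big block_of xpredT) //=.
rewrite !(big_morph odd oddD (erefl _)); congr (~~ _); apply: eq_bigr => i _.
have [oddU _ sgU _] := sign_block_block_of i.
rewrite (eq_bigr (fun=> block_sign i g : nat)) => [|u ui]; last by rewrite sgU ?inE.
by rewrite sum_nat_const oddM -cardsE oddU.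
Qed.

(** The sign-changing generator fixes the common index and the label of the point 0, which forces
    [d = - d] there; the generators then carry the zero over the whole block by [al_ind]. *)
Lemma minimal_block off N (V : zmodType) (phi : nat -> V) (m : V -> V) (e : V) s1 s2
    (d : 'I_M'.+1 -> int) :
  affine_labelling N phi m e s1 s2 -> (off + N <= M')%N ->
  (forall u, let g := sperm M' (embed off N s1 true M'.+1) in
     d u = vsign (~~ sneg g u) * d (stau g u)) ->
  (forall u, let g := sperm M' (embed off N s2 false M'.+1) in
     d u = vsign (~~ sneg g u) * d (stau g u)) ->
  (forall u : 'I_M'.+1, (off <= u < off + N)%N -> d u = 0) /\ d ord_max = 0.
Proof.
move=> al offN /= d1 d2.
have R1 := al_range1 al; have R2 := al_range2 al.
have I1 := al_inj1 al; have I2 := al_inj2 al.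
split; last first.
  have := d1 ord_max.
  by have [-> ->] := star_gen true offN R1 I1 (erefl : (ord_max : 'I_M'.+1) = M' :> nat);
    rewrite /vsign /=; lia.
have step s fl (u v : 'I_M'.+1) :
    (forall k, (0 < k <= N)%N -> (0 < s k <= N)%N) ->
    (forall j k, (0 < j <= N)%N -> (0 < k <= N)%N -> s j = s k -> j = k) ->
    (forall u, let g := sperm M' (embed off N s fl M'.+1) in
       d u = vsign (~~ sneg g u) * d (stau g u)) ->
    (off <= u < off + N)%N -> (off <= v < off + N)%N ->
    (v.+1 - off = s (u.+1 - off))%N -> d u = vsign (~~ fl) * d v.
  move=> sr si ds uN vN vE; have /= := ds u.
  rewrite stau_sperm // sneg_sperm // /eneg uN => ->; congr (_ * d _).
  have [] := etau_in offN sr uN; rewrite -vE => eN eE; apply: val_inj => /=; lia.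
suff dQ : forall k, (0 < k <= N)%N -> forall u : 'I_M'.+1, (off <= u < off + N)%N ->
    (u.+1 - off = k)%N -> d u = 0.
  by move=> u uN; apply: (dQ (u.+1 - off)%N) => //; lia.
have at_ k : (0 < k <= N)%N ->
    exists2 u : 'I_M'.+1, (off <= u < off + N)%N & (u.+1 - off = k)%N.
  by move=> kN; exists (inord (off + k).-1); rewrite inordK; lia.
apply: (al_ind al) => {}k.
- move=> kN phi0 u uN uk; have s1k : s1 k = k.
    by apply: (al_inj al); rewrite ?R1 // (al_t1 al) // phi0 (morph_add0 (al_add al)).
  have := step s1 true u u R1 I1 d1 uN uN; rewrite uk s1k => /(_ erefl).
  by rewrite /vsign /=; lia.
- move=> kN dk v vN vk; have [u uN uk] := at_ k kN.
  have := step s1 true u v R1 I1 d1 uN vN; rewrite uk vk => /(_ erefl).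
  by rewrite (dk u uN uk) /vsign /=; lia.
move=> kN dk v vN vk; have [u uN uk] := at_ k kN.
have := step s2 false u v R2 I2 d2 uN vN; rewrite uk vk => /(_ erefl).
by rewrite (dk u uN uk) /vsign /=; lia.
Qed.

Theorem product_of_labellings : H1_and_minimal H.
Proof.
split; first exact: gen_WD; split.
  exact: condH1_of_blocks gen_WD sign_block_block_of sum_block_sign.
apply: rel_minimal_of_signed gen_WD _ => d dinv u.
have genH g : g \in gens N1 N2 t1 t2 t1' t2' -> g \in H by apply: mem_gen.
have [||dm1 dstar] := minimal_block (d := d) al1 off1.
- by move=> v /=; apply: dinv; apply: genH; rewrite !inE eqxx.
- by move=> v /=; apply: dinv; apply: genH; rewrite !inE eqxx ?orbT.
have [||dm2 _] := minimal_block (d := d) al2 off2.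
- by move=> v /=; apply: dinv; apply: genH; rewrite !inE eqxx ?orbT.
- by move=> v /=; apply: dinv; apply: genH; rewrite !inE eqxx ?orbT.
have [uN1|uN1] := boolP (0 <= u < 0 + N1)%N; first exact: dm1.
have [uN2|uN2] := boolP (N1 <= u < N1 + N2)%N; first exact: dm2.
suff -> : u = ord_max by [].
by apply: val_inj; have := ltn_ord u; rewrite /=; lia.
Qed.

End ProductOfLabellings.

(** * The dihedral groups *)

Definition cycD_at (n i : nat) : nat :=
  if i == 0%N then 1%N else if (i <= n)%N then (2 * i)%N else (2 * (2 * n + 1 - i) + 1)%N.

Lemma cycDE n : cycD n = [seq cycD_at n i | i <- iota 0 (2 * n + 1)].
Proof.
rewrite /cycD (_ : (2 * n + 1 = (n + n).+1)%N); last by lia.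
rewrite [iota 0 _.+1]/= iotaD map_cons map_cat; congr (_ :: _ ++ _).
  by apply/eq_in_map => i; rewrite mem_iota /cycD_at; do !case: ifP; lia.
(* The descending half of the cycle is reindexed to the positions [n+1] to [2n]. *)
rewrite add1n (_ : n.+1 = (n.+1 + 0)%N) ?iotaDl -?map_comp; last by lia.
by apply/eq_in_map => i; rewrite mem_iota /cycD_at /=; do !case: ifP; lia.
Qed.

Lemma cycD_at_range n i : (i < 2 * n + 1)%N -> (0 < cycD_at n i <= 2 * n + 1)%N.
Proof. by rewrite /cycD_at; do !case: ifP; lia. Qed.

Lemma cycD_at_inj n i j : (i < 2 * n + 1)%N -> (j < 2 * n + 1)%N ->
  cycD_at n i = cycD_at n j -> i = j.
Proof. by rewrite /cycD_at; do !case: ifP; lia. Qed.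

Lemma cycD_at_surj n k : (0 < k <= 2 * n + 1)%N ->
  exists2 i, (i < 2 * n + 1)%N & k = cycD_at n i.
Proof.
move=> kN; exists (if odd k then if k == 1%N then 0%N else (2 * n + 1 - k./2)%N else k./2).
  by do !case: ifP; lia.
by rewrite /cycD_at; do !case: ifP; lia.
Qed.

Lemma tauD2_at n i : (i < 2 * n + 1)%N ->
  tauD2 n (cycD_at n i) = cycD_at n (i.+1 %% (2 * n + 1))%N.
Proof.
move=> iN; have uniq_c : uniq (cycD n).
  rewrite cycDE map_inj_in_uniq ?iota_uniq // => j k.
  by rewrite !mem_iota => jN kN; apply: cycD_at_inj.
have sz : size (cycD n) = (2 * n + 1)%N by rewrite cycDE size_map size_iota.
have nthE x j : (j < 2 * n + 1)%N -> nth x (cycD n) j = cycD_at n j.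
  by move=> jN; rewrite cycDE (nth_map 0%N) ?size_iota // nth_iota.
rewrite /tauD2 next_nth -(nthE 0%N i iN) mem_nth ?sz // index_uniq ?sz //.
have := nthE 1%N i.+1; move: sz; rewrite /cycD /= => -[sz] nthS.
have [iN'|iN'] := ltnP i.+1 (2 * n + 1)%N; first by rewrite nthS // modn_small.
(* Past the last position [nth] returns its default, the head 1 of the cycle, which is the required
   wrap-around. *)
rewrite nth_default ?sz; last by lia.
have -> : (i.+1 = 2 * n + 1)%N by lia.
by rewrite modnn.
Qed.

(** The position of a label in the cycle, modulo [2n+1]: the label [2j] sits at [j] and [2j+1] at
    [-j]. Thus [tauD1] becomes negation and [tauD2] translation by 1. *)
Definition posD (n k : nat) : 'Z_(2 * n + 1) :=
  if odd k then - (k./2)%:R else (k./2)%:R.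

(** Positivity of [n] matters because ['Z_1] is by convention the ring with two elements. *)
Lemma natZN0 n : (0 < n)%N -> (2 * n + 1)%:R = 0 :> 'Z_(2 * n + 1).
Proof. by move=> n0; apply: val_inj; rewrite /= val_Zp_nat ?modnn //; lia. Qed.

Lemma posD_at n i : (0 < n)%N -> (i < 2 * n + 1)%N -> posD n (cycD_at n i) = i%:R.
Proof.
move=> n0 iN; rewrite /posD /cycD_at; case: eqP => [->|i0] /=; first by rewrite oppr0.
case: leqP => lein; first by rewrite oddM (mul2n i) doubleK.
set j := (2 * n + 1 - i)%N.
rewrite (mul2n j) (addn1 j.*2) /= odd_double uphalf_double natrB ?natZN0 ?sub0r ?opprK //.
exact: ltnW.
Qed.

Lemma dihedral_labelling n : (0 < n)%N ->
  affine_labelling (2 * n + 1) (posD n) -%R 1 (tauD1 n) (tauD2 n).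
Proof.
move=> n0; have natI i j : (i < 2 * n + 1)%N -> (j < 2 * n + 1)%N ->
    i%:R = j%:R :> 'Z_(2 * n + 1) -> i = j.
  move=> iN jN /(congr1 val); rewrite /= !val_Zp_nat; [|lia|lia].
  by rewrite !modn_small.
have posI j k : (0 < j <= 2 * n + 1)%N -> (0 < k <= 2 * n + 1)%N ->
    posD n j = posD n k -> j = k.
  by move=> /cycD_at_surj[i iN ->] /cycD_at_surj[i' iN' ->];
    rewrite !posD_at // => /natI->.
split=> //.
- by rewrite addn1 /= oddM.
- exact: opprD.
- by move=> k; rewrite /tauD1; do !case: ifP; lia.
- by move=> k /cycD_at_surj[i iN ->]; rewrite tauD2_at // cycD_at_range // ltn_pmod; lia.
- move=> k kN; rewrite /tauD1; case: ifP => k2; last first.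
    have -> : k = 1%N by lia.
    by rewrite /posD /= !oppr0.
  have [odd_k|even_k] := boolP (odd k).
    have -> : posD n k.-1 = (k.-1)./2%:R by rewrite /posD (_ : odd k.-1 = false) //; lia.
    have -> : k.-1./2 = k./2 by lia.
    by rewrite /posD odd_k opprK.
  have -> : posD n k.+1 = - (k.+1)./2%:R by rewrite /posD /= even_k.
  have -> : k.+1./2 = k./2 by lia.
  by rewrite /posD (negPf even_k).
- move=> k /cycD_at_surj[i iN ->]; rewrite tauD2_at // !posD_at ?ltn_pmod //; [|lia..].
  rewrite -[RHS](natrD _ i 1) addn1.
  by apply: val_inj; rewrite /= !val_Zp_nat ?modn_mod //; lia.
- by move=> j k jN kN /eqP; rewrite oppr_eq0 subr_eq0 => /eqP; apply: posI.
- move=> i j k odd_i jN kN; set x := _ - _ => ix; apply: posI => //.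
  have itx : iter i -%R x = - x.
    rewrite -(odd_double_half i) odd_i /=; congr (- _).
    by elim: i./2 => //= l; rewrite opprK.
  apply/eqP; rewrite -subr_eq0 -/x -[x]mulr1; apply/eqP.
  (* An odd iterate of negation fixing [x] gives [2 x = 0]; together with [(2n+1) x = 0] this yields
     [x = 0]. *)
  have x2 : x *+ 2 = 0 by rewrite mulr2n -{1}ix itx addNr.
  have := mulr0 x; rewrite -[X in x * X](natZN0 n0) mulr_natr mulr1.
  by rewrite mulrnDr mulrnA x2 mul0rn add0r.
move=> Q Q0 _ QS k /cycD_at_surj[i iN ->].
elim: i iN => [|i IHi] iN; first by apply: Q0; rewrite /cycD_at /= ?/posD /= ?oppr0 //; lia.
have iN' : (i < 2 * n + 1)%N by lia.
by have := QS _ (cycD_at_range iN') (IHi iN'); rewrite tauD2_at // modn_small.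
Qed.

(** * The affine groups over finite fields *)

Lemma sum_digits (p r k : nat) : (0 < p)%N ->
  (\sum_(i < r) (k %/ p ^ i %% p) * p ^ i = k %% p ^ r)%N.
Proof.
move=> p0; elim: r => [|r IHr]; first by rewrite big_ord0 expn0 modn1.
rewrite big_ord_recr /= IHr.
have pr0 : (0 < p ^ r)%N by rewrite expn_gt0 p0.
have lt1 := ltn_pmod k pr0; have lt2 := ltn_pmod (k %/ p ^ r) p0.
have kE : (k = k %/ p ^ r %/ p * p ^ r.+1 + (k %/ p ^ r %% p * p ^ r + k %% p ^ r))%N.
  by rewrite expnS mulnA addnA -mulnDl -!divn_eq.
rewrite [in RHS]kE modnMDl [RHS]modn_small 1?addnC //.
apply: (@leq_trans ((k %/ p ^ r %% p).+1 * p ^ r)); last first.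
  by rewrite expnS leq_mul2r lt2 orbT.
by rewrite (mulSn ((k %/ p ^ r) %% p)) ltn_add2r.
Qed.

Lemma digit_sum (p r : nat) (d : nat -> nat) j : (0 < p)%N ->
  (forall i, (d i < p)%N) -> (j < r)%N ->
  ((\sum_(i < r) d i * p ^ i) %/ p ^ j %% p = d j)%N.
Proof.
move=> p0; elim: r d j => // r IHr d j dp jr; rewrite big_ord_recl expn0 muln1.
have -> : (\sum_(i < r) d (lift ord0 i) * p ^ lift ord0 i
           = (\sum_(i < r) d i.+1 * p ^ i) * p)%N.
  by rewrite big_distrl; apply: eq_bigr => i _; rewrite expnSr mulnA.
case: j jr => [|j] jr; first by rewrite expn0 divn1 addnC modnMDl modn_small.
rewrite expnS divnMA addnC divnMDl // (divn_small (dp 0%N)) addn0.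
by apply: (IHr (d \o S)) => //= i; apply: dp.
Qed.

Lemma sum_digits_lt (p r : nat) (d : nat -> nat) : (0 < p)%N ->
  (forall i, (d i < p)%N) -> (\sum_(i < r) d i * p ^ i < p ^ r)%N.
Proof.
move=> p0 dp; elim: r => [|r IHr]; first by rewrite big_ord0.
rewrite big_ord_recr /= expnS; apply: (@leq_trans ((d r).+1 * p ^ r)).
  by rewrite (mulSn (d r)) ltn_add2r.
by rewrite leq_mul2r dp orbT.
Qed.

(** * Labels as base-p digits of reduced polynomials *)

Section Labels.
Variables (p r : nat).
Hypothesis (p_pr : prime p).

Let p_gt0 : (0 < p)%N := prime_gt0 p_pr.

Lemma Fp_lt (x : 'F_p) : (x < p)%N.
Proof. by have := ltn_ord x; rewrite [X in (_ < X)%N -> _]Fp_cast. Qed.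

Lemma coef_unlab k i : k != (p ^ r)%N -> (i < r)%N ->
  nat_of_ord ((unlab p r k)`_i)%R = (k %/ p ^ i %% p)%N.
Proof. by move=> kq ir; rewrite /unlab (negPf kq) coef_poly ir val_Fp_nat // modn_mod. Qed.

Lemma size_unlab k : (size (unlab p r k) <= r)%N.
Proof. by rewrite /unlab; case: eqP => _; rewrite ?size_poly0 ?size_poly. Qed.

Lemma unlabK k : (0 < k <= p ^ r)%N -> lab p r (unlab p r k) = k.
Proof.
move=> /andP[k0]; rewrite leq_eqVlt => /predU1P[->|kq].
  by rewrite /lab /unlab !eqxx.
have kE : (\sum_(i < r) nat_of_ord ((unlab p r k)`_i)%R * p ^ i = k)%N.
  rewrite -[RHS](modn_small kq) -sum_digits //; apply: eq_bigr => i _.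
  by rewrite coef_unlab ?ltn_eqF.
(* A zero polynomial would have digit sum 0, contradicting [0 < k], so the special label of 0 does
   not interfere. *)
rewrite /lab; case: eqP => // u0; move: kE k0; rewrite u0 big1 => [<- //|i _].
by rewrite coef0.
Qed.

Lemma labK (a : {poly 'F_p}) : (size a <= r)%N -> unlab p r (lab p r a) = a.
Proof.
move=> sa; rewrite /lab; case: eqP => [->|_]; first by rewrite /unlab eqxx.
pose d i := nat_of_ord (a`_i)%R; have dp i : (d i < p)%N by apply: Fp_lt.
rewrite /unlab ltn_eqF ?(sum_digits_lt r p_gt0 dp) //; apply/polyP=> i.
rewrite coef_poly; case: ltnP => ir; last by rewrite nth_default // (leq_trans sa).
by rewrite (digit_sum p_gt0 dp ir) natr_Zp.
Qed.

Lemma lab_range (a : {poly 'F_p}) : (size a <= r)%N -> (0 < lab p r a <= p ^ r)%N.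
Proof.
move=> sa; have q0 : (0 < p ^ r)%N by rewrite expn_gt0 p_gt0.
apply/andP; split; last first.
  rewrite /lab; case: eqP => // _; apply: ltnW.
  by apply: (@sum_digits_lt _ _ (fun i => nat_of_ord (a`_i)%R)) => // i; apply: Fp_lt.
(* A label 0 would come back as the zero polynomial, whose label is [p ^ r]. *)
rewrite lt0n; apply/eqP => l0; have := labK sa; rewrite l0 => a0.
have : a = 0.
  rewrite -a0 /unlab; case: eqP => // _; apply/polyP=> i.
  by rewrite coef_poly coef0 div0n mod0n; case: ifP.
by move: l0; rewrite /lab => + aE; rewrite aE eqxx; move: q0 => /[swap] ->.
Qed.

End Labels.

(** A nonzero [d] of degree smaller than the irreducible [h] is coprime to [h]. *)
Lemma irreducible_dvdp_mul (F : fieldType) (h a d : {poly F}) :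
  irreducible_poly h -> (size d < size h)%N -> d != 0 -> h %| a * d -> h %| a.
Proof.
move=> [_ irr] sd d0; rewrite Gauss_dvdpl //; rewrite coprimep_def.
apply/negPn/negP=> /irr/(_ (dvdp_gcdl _ _)) eqh.
have : h %| d by rewrite -(eqp_dvdl _ eqh) dvdp_gcdr.
by move/(dvdp_leq d0); rewrite leqNgt sd.
Qed.

Lemma dvdp_subXX (F : fieldType) (h a b : {poly F}) n :
  h %| a - b -> h %| a ^+ n - b ^+ n.
Proof. by move=> hab; rewrite subrXX dvdp_mulr. Qed.

(** * Multiplication by a generator of the unit group *)

Section FiniteField.
Variables (p r : nat) (h Gam : {poly 'F_p}).
Hypotheses (p_pr : prime p) (p_odd : odd p) (r_gt0 : (0 < r)%N).
Hypotheses (size_h : size h = r.+1) (irr_h : irreducible_poly h).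
Hypothesis genG : generates_units p r h Gam.

Let h_neq0 : h != 0. Proof. by rewrite -size_poly_gt0 size_h. Qed.

Lemma h_ndvd2 : ~~ (h %| 2%:R).
Proof.
have two : (2%:R : 'F_p) != 0.
  rewrite -(dvdn_pcharf (pchar_Fp p_pr)) dvdn_prime2 //.
  by apply: contraTneq p_odd => ->.
apply/negP; rewrite -polyC_natr => /dvdp_leq.
by rewrite polyC_eq0 size_polyC two size_h => /(_ isT); lia.
Qed.

Lemma minus1_power : exists j, h %| Gam ^+ j + 1.
Proof.
have [||j jE] := genG.2 (-1); first by rewrite size_polyN size_poly1.
  by rewrite oppr_eq0 oner_neq0.
exists j; rewrite /dvdp modpD -jE modp_small ?addNr // size_poly1 size_h; lia.
Qed.

(* [-1] is a power of [Gam], so an odd power of [Gam] equal to [1] would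
   force [-1 = 1]. *)
Lemma odd_power_neq1 n : odd n -> ~~ (h %| Gam ^+ n - 1).
Proof.
move=> odd_n; have [j hj] := minus1_power; apply/negP => hn.
(* Modulo [h], the power [Gam^(j n)] is computed both as [(-1)^n = -1] and as [1^j = 1]. *)
have h1 : h %| Gam ^+ (j * n) + 1.
  have := @dvdp_subXX _ h (Gam ^+ j) (-1) n; rewrite opprK => /(_ hj).
  by rewrite -exprM -signr_odd odd_n expr1 opprK.
have h2 : h %| Gam ^+ (j * n) - 1.
  by have := dvdp_subXX j hn; rewrite -exprM mulnC expr1n.
have := dvdp_sub h1 h2; rewrite (_ : _ - _ = 2%:R); last by ring.
by rewrite (negPf h_ndvd2).
Qed.

(** If [h] divided [Gam], then from [h %| Gam ^+ j + 1] it would divide 1, or 2 when [j = 0]. *)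
Lemma Gam_coprime (d : {poly 'F_p}) : (size d <= r)%N -> h %| Gam * d -> d = 0.
Proof.
move=> sd hd; apply/eqP/negPn/negP => d0.
have hG : h %| Gam by apply: irreducible_dvdp_mul hd; rewrite ?size_h.
have [[|j] hj] := minus1_power; first by have := h_ndvd2; rewrite hj.
have : h %| 1 by rewrite -(@dvdp_addr _ (Gam ^+ j.+1)) // exprS dvdp_mulr.
by rewrite dvdp1 size_h; lia.
Qed.

(** For odd [n], [Gam^n - 1] is not divisible by the irreducible [h], so no nonzero reduced
    difference is fixed by [Gam^n]. *)
Lemma finite_field_labelling :
  affine_labelling (p ^ r) (unlab p r) (fun x => (Gam * x) %% h) 1
    (tauMu p r h Gam) (tauNu p r).
Proof.
have size_modh (x : {poly 'F_p}) : (size (x %% h)%R <= r)%N.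
  by rewrite -ltnS -size_h ltn_modp.
have sizeB j k : (size (unlab p r j - unlab p r k)%R <= r)%N.
  by rewrite (leq_trans (size_polyD _ _)) // geq_max size_polyN !size_unlab.
have size1 k : (size (unlab p r k + 1)%R <= r)%N.
  by rewrite (leq_trans (size_polyD _ _)) // geq_max size_unlab size_poly1.
have unlab_inj j k : (0 < j <= p ^ r)%N -> (0 < k <= p ^ r)%N ->
    unlab p r j = unlab p r k -> j = k.
  by move=> jN kN /(congr1 (lab p r)); rewrite !unlabK.
split=> //.
- by rewrite oddX p_odd orbT.
- by move=> x y; rewrite mulrDr modpD.
- by move=> k kN; apply: lab_range.
- by move=> k kN; apply: lab_range.
- by move=> k kN; rewrite labK.
- by move=> k kN; rewrite labK.
- move=> j k jN kN /eqP d0; apply: unlab_inj => //; apply/eqP.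
  by rewrite -subr_eq0; apply/eqP/Gam_coprime.
- move=> n j k odd_n jN kN; set d := _ - _ => nd; apply: unlab_inj => //.
  have iterE i : (iter i (fun x => (Gam * x) %% h) d) %% h = (Gam ^+ i * d) %% h.
    elim: i => [|i IHi]; first by rewrite mul1r.
    by rewrite /= modp_id -modp_mul IHi modp_mul exprS mulrA.
  apply/eqP; rewrite -subr_eq0 -/d; apply/negPn/negP => d0.
  have := odd_power_neq1 odd_n; rewrite (irreducible_dvdp_mul irr_h _ d0) //.
    by rewrite size_h ltnS sizeB.
  by rewrite mulrBl mul1r /dvdp modpD modpN -iterE nd subrr.
move=> Q Q0 Q1 Q2.
have lab0 : (0 < p ^ r <= p ^ r)%N by rewrite leqnn expn_gt0 prime_gt0.
have unlab0 : unlab p r (p ^ r) = 0 by rewrite /unlab eqxx.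
(* One translation leads from 0 to 1, and multiplications by [Gam] then reach all its powers, that
   is, every nonzero point. *)
have Qpow j : exists k, [/\ (0 < k <= p ^ r)%N, Q k & unlab p r k = (Gam ^+ j) %% h].
  elim: j => [|j [k [kN Qk kE]]].
    exists (tauNu p r (p ^ r)); split; [exact: lab_range|exact/Q2/Q0|].
    by rewrite labK // unlab0 add0r expr0 modp_small // size_poly1 size_h.
  exists (tauMu p r h Gam k); split; [exact: lab_range|exact: Q1|].
  by rewrite labK // kE modp_mul exprS.
move=> k kN; have [/eqP|k0] := boolP (unlab p r k == 0); first exact: Q0.
have [j kE] := genG.2 _ (size_unlab p r k) k0; have [k' [k'N Qk' k'E]] := Qpow j.
by rewrite (unlab_inj k k' kN k'N) // kE k'E.
Qed.

End FiniteField.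

Theorem theorem7p4 :
  (* D_{2n1+1} x D_{2n2+1} *)
  (forall n1 n2 : nat, (0 < n1)%N -> (0 < n2)%N ->
     H1_and_minimal
       <<gens (2 * n1 + 1) (2 * n2 + 1)
              (tauD1 n1) (tauD2 n1) (tauD1 n2) (tauD2 n2)>>%g)
  /\
  (* D_{2n+1} x F_{p^r} *)
  (forall (n p r : nat) (h Gam : {poly 'F_p}),
     (0 < n)%N -> prime p -> odd p -> (0 < r)%N ->
     h \is monic -> size h = r.+1 -> irreducible_poly h ->
     generates_units p r h Gam ->
     H1_and_minimal
       <<gens (2 * n + 1) (p ^ r)
              (tauD1 n) (tauD2 n) (tauMu p r h Gam) (tauNu p r)>>%g).
Proof.
split=> [n1 n2 n1_gt0 n2_gt0 | n p r h Gam n_gt0 p_pr p_odd r_gt0 _ sz_h irr_h genG].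
  exact: product_of_labellings (dihedral_labelling n1_gt0) (dihedral_labelling n2_gt0).
apply: product_of_labellings (dihedral_labelling n_gt0) _.
exact: finite_field_labelling.
Qed.
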